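(* Let $N>0$ be an integer. Then the triple $(\mathrm{PC}^{\mathtt{tt}}_{\infty}(K_N,\Sigma_N),\le,r)$ is a topological Ramsey space.
   Context: Natural numbers are identified with the sets of their predecessors; $\omega=\{0,1,2,\dots\}$. FP creatures. Let $\mathbf H$ be a function on $\omega$ with each $\mathbf H(i)$ a finite non-empty set. $\mathcal F_{\mathbf H}$ is the set of all finite non-empty functions $f$ with $\mathrm{dom}(f)\subseteq\omega$ and $f(i)\in\mathbf H(i)$ for all $i\in\mathrm{dom}(f)$. An FP creature for $\mathbf H$ is a tuple $t=(\mathbf{nor}[t],\mathbf{val}[t],\mathbf{dis}[t],m^t_{\mathrm{dn}},m^t_{\mathrm{up}})$ where $\mathbf{nor}[t]$ is a non-negative real, $\mathbf{dis}[t]$ is an arbitrary object, $m^t_{\mathrm{dn}}<m^t_{\mathrm{up}}<\omega$, and $\mathbf{val}[t]$ is a non-empty finite subset of $\mathcal F_{\mathbf H}$ with $\mathrm{dom}(f)\subseteq[m^t_{\mathrm{dn}},m^t_{\mathrm{up}})$ for all $f\in\mathbf{val}[t]$. The pair $(K_N,\Sigma_N)$. Let $\mathbf H_N(n)=N=\{0,\dots,N-1\}$ for $n<\omega$. $K_N$ consists of all FP creatures $t$ for $\mathbf H_N$ such that: $\mathbf{dis}[t]=(X_t,\varphi_t)$ where $X_t\subsetneq[m^t_{\mathrm{dn}},m^t_{\mathrm{up}})$ and $\varphi_t:X_t\to N$; $\mathbf{nor}[t]=m^t_{\mathrm{up}}$; and $\mathbf{val}[t]$ is the set of all $f:[m^t_{\mathrm{dn}},m^t_{\mathrm{up}})\to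 N$ such that $\varphi_t\subseteq f$ and $f$ is constant on $[m^t_{\mathrm{dn}},m^t_{\mathrm{up}})\setminus X_t$. For $t_0,\dots,t_n\in K_N$ with $m^{t_l}_{\mathrm{up}}=m^{t_{l+1}}_{\mathrm{dn}}$ for all $l<n$, $\Sigma_N(t_0,\dots,t_n)$ consists of all $t\in K_N$ such that $m^t_{\mathrm{dn}}=m^{t_0}_{\mathrm{dn}}$, $m^t_{\mathrm{up}}=m^{t_n}_{\mathrm{up}}$, $X_{t_0}\cup\dots\cup X_{t_n}\subseteq X_t$, and for each $l\le n$, either $X_t\cap[m^{t_l}_{\mathrm{dn}},m^{t_l}_{\mathrm{up}})=X_{t_l}$ and $\varphi_t\restriction[m^{t_l}_{\mathrm{dn}},m^{t_l}_{\mathrm{up}})=\varphi_{t_l}$ (restriction to the part of the domain $X_t$ lying in this interval), or $[m^{t_l}_{\mathrm{dn}},m^{t_l}_{\mathrm{up}})\subseteq X_t$ and $\varphi_t\restriction[m^{t_l}_{\mathrm{dn}},m^{t_l}_{\mathrm{up}})\in\mathbf{val}[t_l]$. Tight pure candidates. $\mathrm{PC}^{\mathtt{tt}}_{\infty}(K_N,\Sigma_N)$ is the set of all infinite sequences $\bar t=(t_0,t_1,\dots)$ of members of $K_N$ such that $m^{t_n}_{\mathrm{up}}=m^{t_{n+1}}_{\mathrm{dn}}$ for all $n$ and $\lim_{n\to\infty}\mathbf{nor}[t_n]=\infty$ (the latter is automatic here). It is ordered by: $\bar t\le\bar s$ iff there is a strictly increasing sequence $(j_n)_{n<\omega}$ of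 natural numbers such that $t_n\in\Sigma_N(s_{j_n},\dots,s_{j_{n+1}-1})$ for each $n$ ($j_0$ need not be $0$). The restriction maps are $r_k(\bar t)=(t_i:i<k)$, $k<\omega$. Topological Ramsey spaces. For a set $\mathcal R$ of infinite sequences $\bar t=(t_0,t_1,\dots)$ with quasi-order $\le$ and restriction maps $r_k(\bar t)=(t_i:i<k)$, $k<\omega$, let $\mathcal{AR}=\{r_k(\bar t):k<\omega,\ \bar t\in\mathcal R\}$, and for $a\in\mathcal{AR}$, $\bar t\in\mathcal R$ let $[a,\bar t\,]=\{\bar s\in\mathcal R:\bar s\le\bar t\text{ and }r_k(\bar s)=a\text{ for some }k<\omega\}$. The Ellentuck topology on $\mathcal R$ is generated by the sets $[a,\bar t\,]$ as basic open sets. Nowhere dense and meager are taken with respect to this topology, and $\mathcal X\subseteq\mathcal R$ has the property of Baire if $\mathcal X=\mathcal O\,\triangle\,\mathcal M$ with $\mathcal O$ Ellentuck open and $\mathcal M$ Ellentuck meager. $\mathcal X\subseteq\mathcal R$ is Ramsey if for every non-empty $[a,\bar t\,]$ there is $\bar s\in[a,\bar t\,]$ with $[a,\bar s\,]\subseteq\mathcal X$ or $[a,\bar s\,]\cap\mathcal X=\emptyset$; it is Ramsey null if for every non-empty $[a,\bar t\,]$ there is $\bar s\in[a,\bar t\,]$ with $[a,\bar s\,]\cap\mathcal X=\emptyset$. $(\mathcal R,\le,r)$ is a topological Ramsey space if every subset of $\mathcal R$ with the property of Baire is Ramsey and every meager subset of $\mathcal R$ is Ramsey null. *)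

(* Defs.v *)
From HB Require Import structures.
From mathcomp Require Import all_boot all_order all_algebra finmap.
From mathcomp Require Import all_classical all_reals all_analysis.

Set Implicit Arguments.
Unset Strict Implicit.
Unset Printing Implicit Defensive.

Import Order.TTheory GRing.Theory Num.Theory.
Import numFieldNormedType.Exports.

Local Open Scope classical_set_scope.

Definition restr (T : Type) (k : nat) (t : nat -> T) : seq T := mkseq t k.

(* The quasi-order [le] is a parameter of this alias of [R] because it
   determines the topology. *)
Definition ellentuck (T : Type) (R : set (nat -> T))
  (le : (nat -> T) -> (nat -> T) -> Prop) : Type := set_type R.

Definition approximations (T : Type) (R : set (nat -> T)) : set (seq T) :=
  [set a | exists k t, R t /\ a = restr k t].

Definition basic_set (T : Type) (R : set (nat -> T))
    (le : (nat -> T) -> (nat -> T) -> Prop) (a : seq T) (t : ellentuck R le) :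
    set (ellentuck R le) :=
  [set s | le (set_val s) (set_val t) /\ exists k, restr k (set_val s) = a].

Section EllentuckTopology.
Context (T : Type) (R : set (nat -> T)).
Context (le : (nat -> T) -> (nat -> T) -> Prop).

HB.instance Definition _ := gen_eqMixin (ellentuck R le).
HB.instance Definition _ := gen_choiceMixin (ellentuck R le).

(* The factory takes a subbase, so it carries no proof obligation. When [le]
   is a quasi-order on [R], the sets [basic_set a t] form a base: if s lies in
   two of them, given by a and b, then so does [basic_set c s], where c is the
   longer of a and b. *)
HB.instance Definition _ := isSubBaseTopological.Build (ellentuck R le)
  [set U | exists a t, approximations R a /\ U = @basic_set T R le a t] id.

End EllentuckTopology.

Definition nowhere_dense (X : topologicalType) (A : set X) : Prop :=
  interior (closure A) = set0.

Definition meager (X : topologicalType) (A : set X) : Prop :=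
  exists F : nat -> set X,
    (forall n, nowhere_dense (F n)) /\ A = \bigcup_n F n.

Definition Baire_property (X : topologicalType) (A : set X) : Prop :=
  exists O M : set X, [/\ open O, meager M & A = O `+` M].

Definition Ramsey (T : Type) (R : set (nat -> T))
    (le : (nat -> T) -> (nat -> T) -> Prop) (X : set (ellentuck R le)) : Prop :=
  forall (a : seq T) (t : ellentuck R le), approximations R a ->
    basic_set a t !=set0 ->
    exists2 s, basic_set a t s &
      basic_set a s `<=` X \/ basic_set a s `&` X = set0.

Definition Ramsey_null (T : Type) (R : set (nat -> T))
    (le : (nat -> T) -> (nat -> T) -> Prop) (X : set (ellentuck R le)) : Prop :=
  forall (a : seq T) (t : ellentuck R le), approximations R a ->
    basic_set a t !=set0 ->
    exists2 s, basic_set a t s & basic_set a s `&` X = set0.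

Definition quasi_order_on (A : Type) (S : set A) (le : A -> A -> Prop) : Prop :=
  (forall x, S x -> le x x) /\
  (forall x y z, S x -> S y -> S z -> le x y -> le y z -> le x z).

Definition topological_Ramsey_space (T : Type) (R : set (nat -> T))
    (le : (nat -> T) -> (nat -> T) -> Prop) : Prop :=
  [/\ quasi_order_on R le,
      forall X : set (ellentuck R le), Baire_property X -> Ramsey X &
      forall X : set (ellentuck R le), meager X -> Ramsey_null X].

Definition interval_fset (m n : nat) : {fset nat} :=
  [fset i in index_iota m n]%fset.

Definition finite_functions (V : choiceType) (H : nat -> {fset V}) :
    set {fmap nat -> V} :=
  [set f | domf f != fset0 /\ forall i (fi : i \in domf f), f.[fi]%fmap \in H i].

(* The raw tuples; [D] is the type in which the otherwise arbitrary component
   [dis] lives. *)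
Record creature (R : realType) (V : choiceType) (D : Type) := Creature {
  nor : R;
  val_of : {fset {fmap nat -> V}};
  dis : D;
  m_dn : nat;
  m_up : nat
}.

Definition FP_creature (R : realType) (V : choiceType) (D : Type)
    (H : nat -> {fset V}) : set (creature R V D) :=
  [set t | [/\ (0 <= nor t)%R, (m_dn t < m_up t)%N, val_of t != fset0,
     (forall f, f \in val_of t -> finite_functions H f) &
     (forall f, f \in val_of t ->
        (domf f `<=` interval_fset (m_dn t) (m_up t))%fset)]].
Arguments FP_creature {R V} D H.

Definition tight_pure_candidates (R : realType) (V : choiceType) (D : Type)
    (K : set (creature R V D)) : set (nat -> creature R V D) :=
  [set t | [/\ forall n, K (t n), forall n, m_up (t n) = m_dn (t n.+1) &
     (fun n => nor (t n)) @ \oo --> +oo%R]].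

Definition pc_le (R : realType) (V : choiceType) (D : Type)
    (Sigma : seq (creature R V D) -> set (creature R V D))
    (t s : nat -> creature R V D) : Prop :=
  exists2 j : nat -> nat, {homo j : m n / (m < n)%N} &
    forall n, Sigma [seq s i | i <- index_iota (j n) (j n.+1)] (t n).

Definition H_N (N : nat) (n : nat) : {fset nat} := interval_fset 0 N.

Definition N_creature (R : realType) : Type :=
  creature R nat ({fset nat} * {fmap nat -> nat})%type.

Section KSigma.
Context (R : realType) (N : nat).
Implicit Types t u : N_creature R.

Definition block t : {fset nat} := interval_fset (m_dn t) (m_up t).
Definition X_of t : {fset nat} := (dis t).1.
Definition phi_of t : {fmap nat -> nat} := (dis t).2.

Definition K_N : set (N_creature R) :=
  [set t | FP_creature _ (H_N N) t /\
   [/\ (X_of t `<` block t)%fset,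
       domf (phi_of t) = X_of t /\
         (forall i (xi : i \in domf (phi_of t)), ((phi_of t).[xi]%fmap < N)%N),
       nor t = (m_up t)%:R%R &
       forall f : {fmap nat -> nat}, f \in val_of t <->
         [/\ domf f = block t,
             forall i (fi : i \in domf f), (f.[fi]%fmap < N)%N,
             f.[& X_of t]%fmap = phi_of t &
             exists c, forall i, i \in (block t `\` X_of t)%fset ->
               f.[? i]%fmap = Some c]]].

(* Sigma_N is defined for nonempty lists of consecutive members of K_N; it is
   given the value [set0] at all other lists. *)
Definition Sigma_N (ts : seq (N_creature R)) : set (N_creature R) :=
  if ts is t0 :: ts' then
    [set t |
      [/\ forall l, (l < size ts)%N -> K_N (nth t0 ts l),
          forall l, (l.+1 < size ts)%N ->
            m_up (nth t0 ts l) = m_dn (nth t0 ts l.+1) &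
          K_N t] /\
      [/\ m_dn t = m_dn t0,
          m_up t = m_up (last t0 ts'),
          forall l, (l < size ts)%N ->
            (X_of (nth t0 ts l) `<=` X_of t)%fset &
          forall l, (l < size ts)%N ->
            let u := nth t0 ts l in
            ((X_of t `&` block u)%fset = X_of u /\
             (phi_of t).[& block u]%fmap = phi_of u) \/
            ((block u `<=` X_of t)%fset /\
             (phi_of t).[& block u]%fmap \in val_of u)]]
  else set0.

End KSigma.
Arguments K_N : clear implicits.
Arguments Sigma_N : clear implicits.

(* Main.v *)
Require Import Defs.
From mathcomp Require Import all_boot all_order all_algebra.
From mathcomp Require Import finmap zify.
From mathcomp Require Import all_classical all_reals all_analysis.

(** A member of K_N is a variable word over the alphabet N, placed at a position
of omega: the elements of X_t carry the letters phi_t, and the remaining places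
carry the variable. In these terms a member of Sigma_N(t_0, ..., t_n) is a
concatenation t_0[y_0] ... t_n[y_n], where each y_l is a letter or the variable
and at least one y_l is the variable.

The pigeonhole principle for one block is Carlson's theorem: let p be a minimal
idempotent ultrafilter on the constant words; then there is an idempotent
ultrafilter q <= p concentrated on the variable words, minimality of p forces
q[a] = p for every letter a, and the Galvin-Glazer construction applied to
qq = pq = qp = q, pp = p gives the homogeneous sequence. This handles blocks
that follow a given nonempty approximation. For the empty approximation, the
first block may start anywhere; by fusion the colour of a block depends only on
where it starts, and merging blocks makes this colour constant.

Fusion works because being a reduct of t is a condition on each block
separately, and because only finitely many approximations end at a given block
of t. Fusion and pigeonhole give the Ellentuck theorem by combinatorial forcing. *)

Set Implicit Arguments.
Unset Strict Implicit.
Unset Printing Implicit Defensive.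

Local Open Scope classical_set_scope.

(** * Idempotent ultrafilters on free monoids *)

(** Zorn's lemma for inclusion. Read through closed sets of ultrafilters, a maximal filter is a
    minimal nonempty closed set with property [Phi]. *)
Lemma maximal_filter (T : Type) (Phi : set_system T -> Prop) (F0 : set_system T) :
  ProperFilter F0 -> Phi F0 ->
  (forall C : set (set_system T), C !=set0 ->
    (forall F, C F -> ProperFilter F /\ Phi F) -> total_on C subset ->
    Phi (\bigcup_(F in C) F)) ->
  exists F, [/\ ProperFilter F, F0 `<=` F, Phi F &
    forall G, ProperFilter G -> Phi G -> F `<=` G -> G = F].
Proof.
move=> F0P F0Phi Phi_chain.
pose P := [set F : set_system T |
  F = set0 \/ [/\ ProperFilter F, F0 `<=` F & Phi F]].
have [C CP totC|F [[->|[FP F0F PhiF]] Fmax]] := @Zorn_bigcup _ P.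
- pose C' := C `&` [set F | F !=set0].
  have CC' : \bigcup_(F in C) F = \bigcup_(F in C') F.
    apply/seteqP; split=> [B [F CF FB]|B [F [CF _] FB]]; last by exists F.
    by exists F => //; split=> //; exists B.
  have C'P F : C' F -> [/\ ProperFilter F, F0 `<=` F & Phi F].
    by case=> /CP[->|//] [? []].
  have totC' : total_on C' subset by move=> F G [CF _] [CG _]; exact: totC.
  have [C'0|/set0P[F1 C'F1]] := eqVneq C' set0.
    by left; rewrite CC' C'0 bigcup_set0.
  have [F1P F0F1 _] := C'P _ C'F1.
  right; rewrite CC'; split.
  + apply: Build_ProperFilter.
      by move=> [F C'F F_0]; have [FP _ _] := C'P _ C'F; exact: filter_not_empty F_0.
    split.
    * by exists F1 => //; exact: filterT.
    * move=> B D [F C'F FB] [G C'G GD].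
      have [FP _ _] := C'P _ C'F; have [GP _ _] := C'P _ C'G.
      have [FG|GF] := totC' _ _ C'F C'G.
        by exists G => //; apply: filterI => //; exact: FG.
      by exists F => //; apply: filterI => //; exact: GF.
    * move=> B D BD [F C'F FB]; exists F => //.
      by have [FP _ _] := C'P _ C'F; exact: filterS FB.
  + by move=> B F0B; exists F1 => //; exact: F0F1.
  + apply: Phi_chain => //; first exact: (ex_intro _ F1 C'F1).
    by move=> F /C'P[].
- exfalso; apply: (Fmax F0); last by right; split.
  by split=> // F00; exact: (F00 _ (@filterT _ F0 _)).
- exists F; split=> // G GP PhiG FG.
  apply: contrapT => GF; apply: (Fmax G).
    by split=> // GF'; apply: GF; apply/seteqP.
  by right; split=> //; exact: subset_trans FG.
Qed.

Lemma ultrafilterP (T : Type) (F : set_system T) : ProperFilter F ->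
  (forall B, F B \/ F (~` B)) -> UltraFilter F.
Proof.
move=> FP FC; split=> // G GP FG; apply/seteqP; split=> // B GB.
have [//|/FG GnB] := FC B.
by exfalso; apply: (@filter_not_empty _ G); rewrite -(setICr B); exact: filterI.
Qed.

Section Convolution.
Context (A : Type).
Implicit Types (F G H : set_system (seq A)) (B : set (seq A)).

(* For ultrafilters this is the product of the Stone-Cech compactification of
   the free monoid; for filters it is the product of the closed sets they
   determine. *)
Definition conv F G : set_system (seq A) :=
  [set B | F [set x | G [set y | B (x ++ y)]]].

Lemma convA F G H : conv (conv F G) H = conv F (conv G H).
Proof.
apply/funext => B; rewrite /conv /=; congr F; apply/funext => x /=.
congr G; apply/funext => y /=; congr H; apply/funext => z /=.
by rewrite catA.
Qed.

Lemma conv_subl F F' G : F `<=` F' -> conv F G `<=` conv F' G.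
Proof. by move=> FF' B; exact: FF'. Qed.

Lemma conv_subr F G G' : Filter F -> G `<=` G' -> conv F G `<=` conv F G'.
Proof. by move=> FF GG' B; apply: (@filterS _ F) => x; exact: GG'. Qed.

Lemma conv_filter F G : Filter F -> Filter G -> Filter (conv F G).
Proof.
move=> FF GG; split.
- by apply: (@filterS _ F) filterT => x _; exact: filterT.
- move=> B C FB FC; apply: (@filterS _ F) (@filterI _ F _ _ _ FB FC) => x [GB GC].
  exact: (@filterI _ G).
- move=> B C BC; apply: (@filterS _ F) => x /=; apply: (@filterS _ G) => y.
  exact: BC.
Qed.

Lemma conv_proper F G : ProperFilter F -> ProperFilter G -> ProperFilter (conv F G).
Proof.
move=> FF GG; apply: Build_ProperFilter; last exact: conv_filter.
by move=> /(@filter_ex _ F)[x] /(@filter_ex _ G)[y].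
Qed.

Lemma conv_ultra F G : UltraFilter F -> UltraFilter G -> UltraFilter (conv F G).
Proof.
move=> FU GU; apply: ultrafilterP => [|B]; first exact: conv_proper.
have [|FB] := in_ultra_setVsetC [set x | G [set y | B (x ++ y)]] FU; first by left.
right; apply: (@filterS _ F) FB => x /=.
by have [|] := in_ultra_setVsetC [set y | B (x ++ y)] GU.
Qed.

(** Seen as a closed set of ultrafilters, this consists of the [x] extending [F] for which
    [conv x e] extends [r]. *)
Definition quotient_filter F e r : set_system (seq A) :=
  [set C | exists D B, [/\ F D, r B &
     D `&` [set w | e [set y | B (w ++ y)]] `<=` C]].

(** If [D] missed the trace of [B], the ultrafilter [e] would put the complement of [B] into
    [conv F e], hence into [r], which contains [B]. *)
Lemma quotient_filter_proper F e r : Filter F -> UltraFilter e -> ProperFilter r ->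
  conv F e `<=` r -> ProperFilter (quotient_filter F e r).
Proof.
move=> FF eU rP Fer; apply: Build_ProperFilter; last split.
- move=> [D [B [FD rB DB]]]; apply: (@filter_not_empty _ r).
  rewrite -(setICr B); apply: filterI => //; apply: Fer.
  apply: filterS FD => w Dw /=.
  have [eB|//] := in_ultra_setVsetC [set y | B (w ++ y)] eU.
  by have := DB w (conj Dw eB).
- by exists setT, setT; split=> //; exact: filterT.
- move=> C C' [D [B [FD rB DB]]] [D' [B' [FD' rB' DB']]].
  exists (D `&` D'), (B `&` B'); split; [exact: filterI|exact: filterI|].
  move=> w [[Dw D'w] /= eBB']; split.
    by apply: DB; split=> //=; apply: filterS eBB' => y [].
  by apply: DB'; split=> //=; apply: filterS eBB' => y [].
- move=> C C' CC' [D [B [FD rB DB]]]; exists D, B; split=> //.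
  exact: subset_trans CC'.
Qed.

Lemma sub_quotient_filter F e r : Filter r -> F `<=` quotient_filter F e r.
Proof.
by move=> rF D FD; exists D, setT; split=> [//||w []//]; exact: filterT.
Qed.

Lemma sub_conv_quotient_filter F e r : Filter F ->
  r `<=` conv (quotient_filter F e r) e.
Proof.
by move=> FF B rB; exists setT, B; split=> [|//|w []//]; exact: filterT.
Qed.

(** An ultrafilter is maximal among proper filters, so the inclusion of [r] in [conv x e], for [x]
    the quotient filter, is an equality. *)
Lemma conv_quotient F e r : Filter F -> UltraFilter e -> UltraFilter r ->
  conv F e `<=` r -> exists2 x, ProperFilter x & conv x e = r.
Proof.
move=> FF eU rU Fer.
have xP : ProperFilter (quotient_filter F e r) by exact: quotient_filter_proper.
exists (quotient_filter F e r) => //.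
by apply: max_filter; [exact: conv_proper|exact: sub_conv_quotient_filter].
Qed.

(* Ellis' theorem: filters with [F `<=` conv F F] are closed subsemigroups, and
   a maximal one is a point. *)
Lemma idempotent_ultrafilter F0 : ProperFilter F0 -> F0 `<=` conv F0 F0 ->
  exists p, [/\ UltraFilter p, F0 `<=` p & conv p p = p].
Proof.
move=> F0P F0F0.
have [|F [FP F0F FF Fmax]] :=
  @maximal_filter _ (fun F => F `<=` conv F F) _ F0P F0F0.
  move=> C [F1 CF1] CP totC B [F CF FB].
  have [FP FF] := CP _ CF.
  exists F => //; apply: (@filterS _ F) (FF _ FB) => x Fx /=.
  by exists F.
have [p [pU Fp]] := ultraFilterLemma FP.
(* [conv F p] is a closed subsemigroup inside the minimal one [F], so it is equal to it. *)
have FpF : conv F p = F.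
  apply: Fmax; first exact: conv_proper.
    rewrite -convA; apply: conv_subl.
    apply: (subset_trans FF); apply: conv_subl.
    apply: (subset_trans FF); exact: conv_subr.
  apply: (subset_trans FF); exact: conv_subr.
have sFp : conv F p `<=` p by rewrite FpF.
have QP : ProperFilter (quotient_filter F p p) by exact: quotient_filter_proper.
have FQ : F `<=` quotient_filter F p p by exact: sub_quotient_filter.
(* The solutions [x] of [conv x p = p] in [F] form another closed subsemigroup, hence all of [F]; so
   [conv F p] extends [p], and [F] is the point [p]. *)
have QF : quotient_filter F p p = F.
  apply: Fmax => // C [D [B [FD pB DBC]]].
  have QQ := conv_proper QP QP.
  apply: (filterS DBC).
  apply: filterI.
    apply: (conv_subr _ FQ); exact: (conv_subl FQ (FF _ FD)).
  exists setT, B; split=> //; first exact: filterT.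
  move=> x [_ /= pB']; exists setT, [set y | B (x ++ y)].
  split=> //; first exact: filterT.
  by move=> y [_] /=; apply: filterS => z /=; rewrite catA.
have pF : p `<=` F.
  by rewrite -FpF -[X in conv X p]QF; exact: sub_conv_quotient_filter.
have Ep : p = F by apply/seteqP; split.
exists p; split=> //; first exact: subset_trans Fp.
by move: FpF; rewrite -Ep.
Qed.

(** [Phi] describes closed left ideals, and [p] is an idempotent in a minimal one. An idempotent [e]
    below [p] lies in the same left ideal, so the left ideal [conv T e] is all of it and [p] has the
    form [conv x e]. Then [conv p e] equals [p] as well as [e]. *)
Lemma minimal_idempotent : exists p, [/\ UltraFilter p, conv p p = p &
  forall e, UltraFilter e -> conv e e = e -> conv e p = e -> conv p e = e ->
    e = p].
Proof.
pose Phi F := forall B, F B -> forall x, F [set y | B (x ++ y)].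
pose T : set_system (seq A) := [set B | B = setT].
have TP : ProperFilter T.
  apply: Build_ProperFilter => [T0|].
    have : [set: seq A] [::] by [].
    by rewrite -T0.
  split=> // [B C -> ->|B C BC BT]; first exact: setIT.
  by apply/seteqP; split=> // x _; apply: BC; rewrite BT.
have [|C _ CP _ B [F CF FB] x|F [FP _ FPhi Fmax]] := @maximal_filter _ Phi _ TP.
- by move=> _ -> x; apply/seteqP.
- by exists F => //; have [_ ] := CP _ CF; exact.
have [|p [pU Fp pp]] := @idempotent_ultrafilter F FP.
  by move=> B FB; apply: (@filterS _ F) filterT => x _; exact: FPhi.
exists p; split=> // e eU ee ep pe.
have Fe : F `<=` e.
  move=> B FB; rewrite -ep; apply: (@filterS _ e) filterT => x _ /=.
  by apply: Fp; exact: FPhi.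
have TeF : conv T e = F.
  apply: Fmax; first exact: conv_proper.
    move=> B TeB x; apply/seteqP; split=> // y _ /=.
    have : [set: seq A] (x ++ y) by [].
    by rewrite -TeB /=; apply: filterS => z /=; rewrite catA.
  move=> B FB; apply/seteqP; split=> // x _ /=.
  by apply: Fe; exact: FPhi.
have [x xP xe] : exists2 x, ProperFilter x & conv x e = p.
  by apply: (@conv_quotient T); rewrite ?TeF.
by rewrite -pe -{1}xe convA ee.
Qed.

End Convolution.

Section Pushforward.
Context (A B : Type) (f : seq A -> seq B).
Hypothesis f_cat : forall x y, f (x ++ y) = f x ++ f y.

Lemma fmap_conv (F G : set_system (seq A)) :
  fmap f (conv F G) = conv (fmap f F) (fmap f G).
Proof.
apply/funext => C; rewrite /conv !fmapE /=; congr F; apply/funext => x /=.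
by congr G; apply/funext => y /=; rewrite /preimage /= f_cat.
Qed.

End Pushforward.

Lemma fmap_ultra (T U : Type) (f : T -> U) (F : set_system T) :
  UltraFilter F -> UltraFilter (fmap f F).
Proof.
move=> FU; apply: ultrafilterP => B; rewrite !fmapE.
exact: in_ultra_setVsetC.
Qed.

Lemma seq_dependent_choice (T : Type) (P : seq T -> Prop) : P [::] ->
  (forall s, P s -> exists y, P (rcons s y)) ->
  exists f : nat -> T, forall n, P (mkseq f n).
Proof.
move=> P0 PS; have [y0 _] := PS _ P0.
have /choice[g gP] : forall s, exists y, P s -> P (rcons s y).
  move=> s; have [/PS[y Py]|nPs] := pselect (P s); first by exists y.
  by exists y0.
pose h n := iter n (fun s => rcons s (g s)) [::].
exists (g \o h) => n.
have -> : mkseq (g \o h) n = h n.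
  by elim: n => // n IH; rewrite mkseqS IH.
by elim: n => //= n; exact: gP.
Qed.

(** * Carlson's theorem *)

Section Words.
Context (L : finType).
Notation word := (seq (option L)).
Implicit Types (W : nat -> word) (u v w : word) (x : option L).

(* [None] is the variable of a word. *)
Definition subst x w : word := [seq if y is Some _ then y else x | y <- w].

(** The coefficients of a combination form a word themselves, so that substituting into a
    combination and composing combinations become operations on coefficient words. *)
Fixpoint act W i v : word :=
  if v is y :: v' then subst y (W i) ++ act W i.+1 v' else [::].

Lemma size_subst x w : size (subst x w) = size w.
Proof. exact: size_map. Qed.

Lemma subst_cat x u v : subst x (u ++ v) = subst x u ++ subst x v.
Proof. exact: map_cat. Qed.

Lemma subst_None w : subst None w = w.
Proof. by rewrite -[RHS]map_id; apply: eq_map; case. Qed.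

Lemma subst_subst x y w : subst x (subst y w) = subst (if y is Some _ then y else x) w.
Proof. by rewrite /subst -map_comp; apply: eq_map; case. Qed.

Lemma act_cat W i u v : act W i (u ++ v) = act W i u ++ act W (i + size u) v.
Proof.
elim: u i => [|y u IH] i /=; first by rewrite addn0.
by rewrite IH catA addSnnS.
Qed.

Lemma eq_act W W' i i' v :
  (forall k, (k < size v)%N -> W (i + k)%N = W' (i' + k)%N) ->
  act W i v = act W' i' v.
Proof.
elim: v i i' => //= y v IH i i' WW'.
have := WW' 0 isT; rewrite !addn0 => ->; congr (_ ++ _).
by apply: IH => k kv; rewrite !addSnnS; exact: WW'.
Qed.

Lemma subst_act W i x v : subst x (act W i v) = act W i (subst x v).
Proof. by elim: v i => //= y v IH i; rewrite subst_cat IH subst_subst. Qed.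

Lemma None_subst x w : None \in w -> (None \in subst x w) = (x == None).
Proof.
move=> Nw; apply/mapP/eqP => [[[//|] _ ->//]|->]; by exists None.
Qed.

Lemma None_act W i v : (forall n, None \in W n) ->
  (None \in act W i v) = (None \in v).
Proof.
move=> WN; elim: v i => //= y v IH i.
by rewrite mem_cat IH None_subst// in_cons eq_sym.
Qed.

(** The ultrafilters on variable words form an ideal, so [conv J p] gives a closed semigroup. Its
    idempotent [r] satisfies [conv r p = r], and multiplying by [p] on the left turns it into an
    idempotent [q] below [p]. *)
Lemma carlson_ultrafilters : exists p q : set_system word,
  [/\ UltraFilter p /\ UltraFilter q,
      [/\ conv p p = p, conv q q = q, conv p q = q & conv q p = q],
      q [set w | None \in w] &
      forall a, fmap (subst (Some a)) q = p].
Proof.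
have [p0 [p0U p0p0 p0min]] := minimal_idempotent L.
pose iota := map (@Some L); pose p := fmap iota p0.
have iota_cat (u v : seq L) : iota (u ++ v) = iota u ++ iota v by exact: map_cat.
have pU : UltraFilter p by exact: fmap_ultra.
have pp : conv p p = p by rewrite -fmap_conv// p0p0.
pose S1 : set word := [set w | None \in w].
pose J : set_system word := [set B | S1 `<=` B].
have JP : ProperFilter J by exact: (@globally_properfilter _ S1 [:: None]).
have [|r [rU Jpr rr]] := @idempotent_ultrafilter _ (conv J p) (conv_proper _ _).
  rewrite -[X in _ `<=` X]convA; apply: conv_subl; rewrite convA.
  move=> B JB x xN; apply: (@filterS _ p) filterT => y _ z zN.
  by apply: JB; rewrite /S1 /= !mem_cat zN !orbT.
have [x xP xp] := conv_quotient _ _ rU Jpr.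
have rp : conv r p = r by rewrite -xp convA pp.
pose q := conv p r.
have qU : UltraFilter q by exact: conv_ultra.
have pq : conv p q = q by rewrite /q -convA pp.
have qp : conv q p = q by rewrite /q convA rp.
have qq : conv q q = q by rewrite {2}/q -convA qp /q convA rr.
exists p, q; split=> //.
  apply: (@filterS _ p) filterT => y _; apply: Jpr => z zN.
  by apply: (@filterS _ p) filterT => t _ /=; rewrite !mem_cat zN !orbT.
(* [rho] reads the variable as [a]. It is a homomorphism that returns [p] to [p0], so it sends [q]
   to an idempotent below the minimal [p0]. *)
move=> a; pose rho := map (@odflt L a).
have rho_cat u v : rho (u ++ v) = rho u ++ rho v by exact: map_cat.
have rhoK : fmap rho p = p0.
  apply/funext => B; rewrite !fmapE /p fmapE.
  congr p0; apply/funext => w; rewrite /preimage /=; congr B.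
  by rewrite /rho /iota -map_comp -[RHS]map_id; exact: eq_map.
have -> : subst (Some a) = iota \o rho.
  by apply/funext => w; rewrite /= /iota /rho -map_comp; apply: eq_map; case.
suff rho_q : fmap rho q = p0 by rewrite /p -rho_q.
apply: p0min; first exact: fmap_ultra.
- by rewrite -fmap_conv// qq.
- by rewrite -{1}rhoK -fmap_conv// qp.
- by rewrite -{1}rhoK -fmap_conv// pq.
Qed.

(* Carlson's theorem, in the form that no [V n] may be skipped. *)
Lemma carlson (Q : set word) : exists V : nat -> word,
  (forall n, None \in V n) /\
  ((forall v, None \in v -> Q (act V 0 v)) \/
   (forall v, None \in v -> ~ Q (act V 0 v))).
Proof.
have [p [q [[pU qU] [pp qq pq qp] qN qp_subst]]] := carlson_ultrafilters.
suff H A : q A -> exists V : nat -> word, (forall n, None \in V n) /\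
    forall v, None \in v -> A (act V 0 v).
  have [/H[V [VN VA]]|/H[V [VN VA]]] := in_ultra_setVsetC Q qU.
    by exists V; split=> //; left.
  by exists V; split=> //; right.
move=> qA.
pose after u : set word := [set y | A (u ++ y)].
(* The next word may enter with the variable, which [q] controls, or with a letter, which [p]
   controls. While [u] is constant it need not lie in [A], and only the continuation by a variable
   is constrained. *)
pose I (s : seq word) := {in s, forall w, None \in w} /\
  forall v, size v = size s -> let u := act (nth [::] s) 0 v in
    q (after u) /\ (None \in v -> A u /\ p (after u)).
have [|s [sN Is]|V VI] := @seq_dependent_choice _ I.
- split=> // v /size0nil -> /=; split=> //.
(* The identities [qq = q] and [qp = q], then [pq = q], then [pp = p], each read as a statement
   about typical prefixes [y]. *)
- have qS B : q B -> q [set y | [/\ B y, q [set z | B (y ++ z)] &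
      p [set z | B (y ++ z)]]].
    move=> qB; have qqB := qB; have qpB := qB.
    rewrite -qq in qqB; rewrite -qp in qpB.
    by apply: (@filterS3 _ q _ _ _ _ _ _ qB qqB qpB) => y; split.
  have pS B : q B -> p [set y | q [set z | B (y ++ z)]].
    by move=> qB; rewrite -pq in qB.
  have ppS B : p B -> p [set y | B y /\ p [set z | B (y ++ z)]].
    move=> pB; have ppB := pB; rewrite -pp in ppB.
    by apply: (@filterS2 _ p _ _ _ _ _ pB ppB) => y; split.
  have q_subst a B : p B -> q [set y | B (subst (Some a) y)].
    by rewrite -(qp_subst a).
  (* The alphabet is finite, so only finitely many [v] and [x] occur and one [y] serves them all. *)
  have /filter_ex[y [/= yN yI]] : q ([set y | None \in y] `&`
      [set y | forall (v : (size s).-tuple (option L)) x,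
        let u := act (nth [::] s) 0 v ++ subst x y in
        q (after u) /\ (None \in rcons v x -> A u /\ p (after u))]).
    apply: filterI => //; apply: filter_forall => v; apply: filter_forall => x.
    have [qv pv] := Is v (size_tuple v).
    set u := act _ 0 v in qv pv *.
    have afterE z : after (u ++ z) = [set t | after u (z ++ t)].
      by apply/funext => t; rewrite /after /= catA.
    case: x => [a|].
      have [vN|vN] := boolP (None \in (v : seq _)).
        have [Au pu] := pv vN.
        apply: (@filterS2 _ q _ _ _ _ _ (q_subst a _ (ppS _ pu))
          (q_subst a _ (pS _ qv))) => z [? ?] ? /=.
        by rewrite afterE; split.
      apply: (@filterS _ q) (q_subst a _ (pS _ qv)) => z /= ?.
      by rewrite afterE; split=> //; rewrite mem_rcons in_cons (negbTE vN).
    apply: (@filterS _ q) (qS _ qv) => z [? ? ?] /=.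
    by rewrite subst_None afterE.
  exists y; split.
    by move=> w; rewrite mem_rcons in_cons => /predU1P[->//|]; exact: sN.
  move=> v'; rewrite size_rcons; case/lastP: v' => // v x.
  rewrite size_rcons => -[vs].
  have := yI (tcast vs (in_tuple v)) x; rewrite val_tcast /=.
  rewrite -cats1 act_cat /= add0n nth_rcons vs ltnn eqxx cats0.
  rewrite (@eq_act (nth [::] (rcons s y)) (nth [::] s) 0 0) //.
  by move=> k; rewrite vs nth_rcons => ->.
- exists V; split=> [n|v vN].
    have [VN _] := VI n.+1; apply: VN.
    by rewrite mkseqS mem_rcons mem_head.
  have [_ /(_ v)] := VI (size v); rewrite size_mkseq => /(_ erefl)[_ /(_ vN)[]].
  by rewrite (@eq_act _ V 0 0) // => k kv; rewrite nth_mkseq.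
Qed.

End Words.

(** * The space of tight sequences of variable words *)

Section Neighborhoods.
Context (T : Type) (R : set (nat -> T)).
Context (le : (nat -> T) -> (nat -> T) -> Prop).

Definition nbd (a : seq T) (t : nat -> T) : set (nat -> T) :=
  [set s | [/\ R s, le s t & restr (size a) s = a]].

(** Stands in for the finitization, amalgamation and closure requirements on the space: one diagonal
    sequence realizes a hereditary dense property at all approximations at once. *)
Definition fusion_property : Prop :=
  forall P : seq T -> (nat -> T) -> Prop,
  (forall b t t', R t -> R t' -> nbd b t' `<=` nbd b t -> P b t -> P b t') ->
  (forall b t, R t -> nbd b t !=set0 -> exists2 t', nbd b t t' & P b t') ->
  forall a t, R t -> nbd a t !=set0 ->
  exists2 s, nbd a t s &
    forall k u, nbd a s u -> (size a <= k)%N -> P (restr k u) s.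

Definition pigeonhole_property : Prop :=
  forall (Q : set T) a t, R t -> nbd a t !=set0 ->
  exists2 s, nbd a t s &
    (forall u, nbd a s u -> Q (u (size a))) \/
    (forall u, nbd a s u -> ~ Q (u (size a))).

End Neighborhoods.

Lemma size_restr (T : Type) k (s : nat -> T) : size (restr k s) = k.
Proof. exact: size_mkseq. Qed.

Lemma restr_eq (T : Type) k (s t : nat -> T) :
  restr k s = restr k t <-> forall i, (i < k)%N -> s i = t i.
Proof.
split=> [st i ik|st]; last first.
  by apply/eq_in_map => i; rewrite mem_iota => /andP[_]; exact: st.
have := congr1 (fun r => nth (s i) r i) st.
by rewrite /restr !nth_mkseq.
Qed.

Lemma seqs_bounded (T : eqType) (s : seq T) M : exists l : seq (seq T),
  forall b, (size b <= M)%N -> {subset b <= s} -> b \in l.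
Proof.
elim: M => [|M [l lP]].
  by exists [:: [::]] => b; rewrite leqn0 size_eq0 => /eqP->; rewrite mem_head.
exists ([::] :: [seq x :: b | x <- s, b <- l]) => -[_ _|x b /= bM bs].
  by rewrite mem_head.
rewrite in_cons; apply/orP; right; apply: allpairs_f.
  by apply: bs; rewrite mem_head.
by apply: lP => // y yb; apply: bs; rewrite in_cons yb orbT.
Qed.

Section Codes.
Context (L : finType).
Notation word := (seq (option L)).
(* A variable word together with the position of its first letter. *)
Definition code : Type := (nat * word)%type.
Implicit Types (x y : code) (c d s t u : nat -> code) (v w : word).

Definition stop x : nat := (x.1 + size x.2)%N.

Definition tight : set (nat -> code) :=
  [set c | forall n, None \in (c n).2 /\ stop (c n) = (c n.+1).1].

Notation words c := (fun k => (c k).2).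

Definition generated c : set code :=
  [set x | exists i v, None \in v /\ x = ((c i).1, act (words c) i v)].

(** No index sequence appears: when [c] and [d] are tight, the positions force consecutive blocks of
    [c] to use adjacent stretches of [d]. *)
Definition reduct c d : Prop := forall n, generated d (c n).

Lemma tight_None c n : tight c -> None \in (c n).2.
Proof. by move=> /(_ n)[]. Qed.

Lemma tight_stop c n : tight c -> stop (c n) = (c n.+1).1.
Proof. by move=> /(_ n)[]. Qed.

Lemma start_leq_mono c : tight c -> {mono (fun n => (c n).1) : m n / (m <= n)%N}.
Proof.
move=> ct; apply: leq_mono; apply: (homo_ltn ltn_trans) => n.
have [Nn <-] := ct n; rewrite /stop -[ltnLHS]addn0 ltn_add2l.
by case: (c n).2 Nn.
Qed.

Lemma start_inj c m n : tight c -> (c m).1 = (c n).1 -> m = n.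
Proof.
by move=> /start_leq_mono cm mn; apply/eqP; rewrite eqn_leq -(cm m n) -(cm n m) mn leqnn.
Qed.

Lemma leq_start c n : tight c -> (n <= (c n).1)%N.
Proof.
move=> ct; elim: n => // n IH; apply: leq_ltn_trans IH _.
by rewrite ltnNge (start_leq_mono ct) ltnn.
Qed.

(** Substitution preserves lengths, so a combination fills exactly the places of the blocks it
    uses. *)
Lemma stop_act c i v : tight c ->
  ((c i).1 + size (act (words c) i v) = (c (i + size v)).1)%N.
Proof.
move=> ct; elim: v i => [|y v IH] i /=; first by rewrite !addn0.
by rewrite size_cat size_subst addnA -addSnnS -IH -(tight_stop _ ct).
Qed.

Lemma generated_None c x : tight c -> generated c x -> None \in x.2.
Proof.
by move=> ct [i [v [vN ->]]]; rewrite None_act// => n; exact: tight_None.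
Qed.

Lemma generated_id c n : generated c (c n).
Proof.
by exists n, [:: None]; rewrite /= subst_None cats0; case: (c n).
Qed.

Lemma generated_stop c x : tight c -> generated c x ->
  exists n, stop x = (c n).1.
Proof.
by move=> ct [i [v [vN ->]]]; exists (i + size v)%N; rewrite -stop_act.
Qed.

Lemma generated_ge c x : tight c -> generated c x -> ((c 0).1 <= x.1)%N.
Proof. by move=> ct [i [v [_ ->]]]; rewrite (start_leq_mono ct). Qed.

(** Positions determine which blocks of [c] are used in [x], so any sequence that has these blocks,
    possibly at shifted indices, generates [x] too. *)
Lemma generated_local c d k k' m x : tight c -> generated c x ->
  ((c k).1 <= x.1)%N -> (stop x <= (c (k + m)).1)%N ->
  (forall i, (i < m)%N -> c (k + i)%N = d (k' + i)%N) -> generated d x.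
Proof.
move=> ct [i [v [vN ->]]]; rewrite /stop /= stop_act// !(start_leq_mono ct).
move=> ki ivm cd; have v0 : (0 < size v)%N by case: v vN {ivm}.
have E j : (j < size v)%N -> c (i + j)%N = d (k' + (i - k) + j)%N.
  move=> jv; have -> : (i + j = k + (i - k + j))%N by lia.
  by rewrite cd ?addnA//; lia.
exists (k' + (i - k))%N, v; split=> //.
have := E 0 v0; rewrite !addn0 => ->; congr (_, _).
by apply: eq_act => j jv; rewrite E.
Qed.

Lemma generated_prefix c d n x : tight c -> generated c x ->
  (stop x <= (c n).1)%N -> (forall i, (i < n)%N -> c i = d i) -> generated d x.
Proof.
by move=> ct cx xn; apply: (@generated_local c d 0 0) => //; exact: generated_ge.
Qed.

Lemma generated_suffix c d k k' x : tight c -> generated c x ->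
  ((c k).1 <= x.1)%N -> (forall i, c (k + i)%N = d (k' + i)%N) -> generated d x.
Proof.
move=> ct cx kx cd; have [n xn] := generated_stop ct cx.
apply: (@generated_local c d k k' n) => //.
by rewrite xn (start_leq_mono ct) leq_addl.
Qed.

(** Coefficients are substituted into coefficients and concatenated; the stretches of [d] are
    adjacent because distinct blocks of [d] start at distinct places. *)
Lemma act_reduct c d i v : tight c -> tight d -> reduct c d ->
  exists i' v', (c i).1 = (d i').1 /\ act (words c) i v = act (words d) i' v'.
Proof.
move=> ct dt cd; elim: v i => [|y v IH] i.
  by have [i' [v' [_ ->]]] := cd i; exists i', [::].
have [i0 [v0 [_ E0]]] := cd i; have [i1 [v1 [E1 E2]]] := IH i.+1.
exists i0, (subst y v0 ++ v1); rewrite act_cat size_subst -subst_act /= E0 /=.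
split=> //; congr (_ ++ _); rewrite E2; congr act.
apply: (start_inj dt); rewrite -E1 -tight_stop// E0.
by rewrite /stop /= stop_act.
Qed.

Lemma reduct_generated c d x : tight c -> tight d -> reduct c d ->
  generated c x -> generated d x.
Proof.
move=> ct dt cd [i [v [vN ->]]].
have [i' [v' [-> E]]] := act_reduct i v ct dt cd.
exists i', v'; split; last by rewrite E.
rewrite -(@None_act _ (words d) i') => [|n]; last exact: tight_None.
by rewrite -E None_act// => n; exact: tight_None.
Qed.

Lemma reduct_refl c : reduct c c.
Proof. by move=> n; exact: generated_id. Qed.

Lemma reduct_trans c d t : tight c -> tight d -> tight t ->
  reduct c d -> reduct d t -> reduct c t.
Proof. by move=> ct dt tt cd dt' n; apply: (reduct_generated dt tt). Qed.

(** The last common block fixes where the next one starts. For [n = 0] there is no such block, which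
    is why the empty approximation is a separate case later. *)
Lemma start_restr s t n : tight s -> tight t -> restr n s = restr n t ->
  (0 < n)%N -> (s n).1 = (t n).1.
Proof.
case: n => // n st tt /restr_eq E _.
by rewrite -!tight_stop// E.
Qed.

Definition join s m n t : nat -> code :=
  fun i => if (i < m)%N then s i else t (n + (i - m))%N.

Lemma joinl s m n t i : (i < m)%N -> join s m n t i = s i.
Proof. by rewrite /join => ->. Qed.

Lemma joinr s m n t i : join s m n t (m + i)%N = t (n + i)%N.
Proof. by rewrite /join ltnNge leq_addr /= addKn. Qed.

Lemma restr_join s m n t : restr m (join s m n t) = restr m s.
Proof. by apply/restr_eq => i; exact: joinl. Qed.

Lemma join_start s m n t : (join s m n t m).1 = (t n).1.
Proof. by have := joinr s m n t 0; rewrite !addn0 => ->. Qed.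

Lemma tight_join s m n t : tight s -> tight t ->
  ((0 < m)%N -> (s m).1 = (t n).1) -> tight (join s m n t).
Proof.
move=> st tt smt i; have [im|mi] := ltnP i m; last first.
  by rewrite -(subnKC mi) -addnS !joinr addnS.
rewrite joinl//; split; first exact: tight_None.
have [im'|] := ltnP i.+1 m; first by rewrite joinl// tight_stop.
move=> mi; have Em : m = i.+1 by apply/eqP; rewrite eqn_leq mi im.
by subst m; rewrite join_start tight_stop// smt.
Qed.

Lemma reduct_join s m n t d : reduct s d -> reduct t d -> reduct (join s m n t) d.
Proof. by move=> sd td i; rewrite /join; case: ifP. Qed.

End Codes.

(** * Fusion and the pigeonhole principle for tight sequences *)

Section CodeSpace.
Context (L : finType).
Notation code := (code L).
Notation tight := (@tight L).
Notation reduct := (@reduct L).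
Notation words c := (fun k => (c k).2).
Implicit Types (x y : code) (c d s t u : nat -> code) (a b : seq code).

(* Of the blocks of [t], [b] uses up only those before [t n], so that [t] can be
   shrunk from [t n] on without affecting [b]. The empty [b], which any block may
   follow, is treated at [n = 0]. *)
Definition ends_at b n t : Prop := exists u,
  [/\ tight u, reduct u t, restr (size b) u = b,
      (u (size b)).1 = (t n).1 & (size b == 0) = (n == 0)].

Lemma ends_at_restr b n t t' : tight t -> tight t' ->
  restr n t = restr n t' -> ends_at b n t -> ends_at b n t'.
Proof.
move=> tt tt' Et [u [ut ru Eb Eu sb]].
have nE : (0 < n)%N -> (t n).1 = (t' n).1 by exact: start_restr.
exists (join u (size b) n t'); split=> //.
- apply: tight_join => // b0; rewrite Eu nE//.
  by move: b0; rewrite !lt0n sb.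
- move=> i; have [ib|bi] := ltnP i (size b); last first.
    by rewrite -(subnKC bi) joinr; exact: generated_id.
  rewrite joinl//; apply: (@generated_prefix _ t t' n) => //.
    by rewrite tight_stop// -Eu (start_leq_mono ut).
  exact/restr_eq.
- by rewrite restr_join.
- exact: join_start.
Qed.

(** All blocks of [b] lie below the start [M] of [t n]; starts increase strictly, so there are at
    most [M] blocks, each a word of length at most [M] over a finite alphabet. *)
Lemma ends_at_bounded n t : tight t ->
  exists l : seq (seq code), forall b, ends_at b n t -> b \in l.
Proof.
move=> tt; pose M := (t n).1.
have [l1 l1P] := seqs_bounded (enum {: option L}) M.
set l2 := [seq (p, w) | p <- iota 0 M.+1, w <- l1].
have [l lP] := seqs_bounded l2 M.
exists l => b [u [ut ru Eb Eu _]]; apply: lP => [|x].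
  by rewrite /M -Eu; exact: leq_start.
rewrite -Eb => /mapP[i]; rewrite mem_iota /= => ib ->.
have : (stop (u i) <= M)%N by rewrite tight_stop// /M -Eu (start_leq_mono ut).
rewrite /stop; case: (u i) => p w /= pw.
apply/allpairsP; exists (p, w); split=> //.
  by rewrite mem_iota /=; lia.
by apply: l1P => [|y _]; [rewrite /=; lia|rewrite mem_enum].
Qed.

Section Fusion.
Variable P : seq code -> (nat -> code) -> Prop.
Hypothesis P_hereditary : forall b t t', tight t -> tight t' ->
  nbd tight reduct b t' `<=` nbd tight reduct b t -> P b t -> P b t'.
Hypothesis P_dense : forall b t, tight t -> nbd tight reduct b t !=set0 ->
  exists2 t', nbd tight reduct b t t' & P b t'.

(** Amalgamation: [b] is continued by [t] from [n] on, the result is shrunk by density, and the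
    shrunk tail is grafted onto the first [n] blocks of [t]. *)
Lemma fusion_step1 b n t : tight t -> ends_at b n t ->
  exists t', [/\ tight t', reduct t' t, restr n t' = restr n t & P b t'].
Proof.
move=> tt [u [ut ru Eb Eu sb]]; set m := size b in Eb Eu sb.
pose u1 := join u m n t.
have u1t : tight u1 by apply: tight_join.
have u1r : reduct u1 t by apply: reduct_join => //; exact: reduct_refl.
have [|t2 [t2t t2u1 Et2] Pt2] := @P_dense b u1 u1t.
  by exists u1; split=> //; [exact: reduct_refl|rewrite restr_join].
have E12 : restr m t2 = restr m u1 by rewrite restr_join Et2.
pose t' := join t n m t2.
have t't : tight t'.
  apply: tight_join => // n0; have m0 : (0 < m)%N by move: n0; rewrite !lt0n sb.
  by rewrite (start_restr t2t u1t E12)// join_start.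
exists t'; split=> //.
- apply: reduct_join; first exact: reduct_refl.
  exact: (reduct_trans t2t u1t tt).
- exact: restr_join.
(* The blocks of [b] are blocks of [t2]; a later block of [s] starts after them and is thus
   generated by the tail that [t'] and [t2] share. *)
- apply: (P_hereditary t2t t't) Pt2 => s [st rs Es]; split=> // i.
  have [im|mi] := ltnP i m.
    have -> : s i = t2 i by have /restr_eq := etrans Es (esym Et2); exact.
    exact: generated_id.
  apply: (@generated_suffix _ t' t2 n m) => //; last first.
    by move=> j; rewrite /t' joinr.
  apply: (@leq_trans (s m).1); last by rewrite (start_leq_mono st).
  rewrite /t' join_start; have [m0|m0] := posnP m.
    rewrite m0; have n0 : n = 0 by apply/eqP; rewrite -sb m0.
    apply: leq_trans (generated_ge t't (rs 0)); rewrite /t' n0.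
    by have := join_start t 0 m t2; rewrite m0 => ->.
  by rewrite (start_restr t2t st (etrans Et2 (esym Es))).
Qed.

Lemma fusion_step n t : tight t -> exists t',
  [/\ tight t', reduct t' t, restr n t' = restr n t &
      forall b, ends_at b n t -> P b t'].
Proof.
move=> tt; have [l lP] := ends_at_bounded n tt.
suff [t' [t't rt' Et' Pt']] : exists t', [/\ tight t', reduct t' t,
    restr n t' = restr n t & forall b, b \in l -> ends_at b n t -> P b t'].
  by exists t'; split=> // b bn; apply: Pt' => //; exact: lP.
elim: {lP} l => [|b l [t1 [t1t rt1 Et1 Pt1]]].
  by exists t; split=> //; exact: reduct_refl.
have [bn|nbn] := pselect (ends_at b n t); last first.
  exists t1; split=> // b'; rewrite in_cons => /predU1P[->//|]; exact: Pt1.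
have [|t' [t't rt' Et' Pt']] := @fusion_step1 b n t1 t1t.
  exact: ends_at_restr bn.
exists t'; split=> //; [exact: (reduct_trans t't t1t tt)|by rewrite Et'|].
move=> b'; rewrite in_cons => /predU1P[->//|b'l] b'n.
apply: (P_hereditary t1t t't) (Pt1 _ b'l b'n) => s [st rs Es]; split=> //.
exact: (reduct_trans st t't t1t).
Qed.

End Fusion.

(** Stage [k] keeps the first [d + k] blocks and settles the finitely many approximations that end
    there. The diagonal sequence is a reduct of every stage, and each approximation of a member ends
    at some block of it. *)
Lemma code_fusion : fusion_property tight reduct.
Proof.
move=> P Pher Pdense a t0 t0t [u0 [u0t u0r Ea]].
set d := size a in Ea.
pose K := {t | tight t}.
have /choice[f fP] : forall nt : nat * K, exists t' : K,
    [/\ reduct (sval t') (sval nt.2), restr nt.1 (sval t') = restr nt.1 (sval nt.2) &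
      forall b, ends_at b nt.1 (sval nt.2) -> P b (sval t')].
  move=> [n [t tt]] /=.
  have [t' [t't rt' Et' Pt']] := fusion_step Pher Pdense n tt.
  by exists (exist _ t' t't).
pose g := fix g k : K := if k is k'.+1 then f ((d + k')%N, g k')
                         else exist _ u0 u0t.
pose h k := sval (g k).
have ht k : tight (h k) by exact: svalP.
have hS k : [/\ reduct (h k.+1) (h k), restr (d + k) (h k.+1) = restr (d + k) (h k) &
    forall b, ends_at b (d + k) (h k) -> P b (h k.+1)].
  exact: (fP (_, _)).
have hr k m : (k <= m)%N -> reduct (h m) (h k).
  elim: m => [|m IH]; first by rewrite leqn0 => /eqP->; exact: reduct_refl.
  rewrite leq_eqVlt => /predU1P[->|/IH hmk]; first exact: reduct_refl.
  by have [hm _ _] := hS m; apply: (reduct_trans _ _ _ hm hmk).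
have hE k m : (k <= m)%N -> restr (d + k) (h m) = restr (d + k) (h k).
  elim: m => [|m IH]; first by rewrite leqn0 => /eqP->.
  rewrite leq_eqVlt => /predU1P[->//|km]; rewrite -IH//.
  have [_ /restr_eq E _] := hS m; apply/restr_eq => i ik; apply: E.
  by apply: leq_trans ik _; rewrite leq_add2l.
(* Stage [k] fixes the entries below [d + k], so entry [i] is final from stage [i.+1] on, even when
   [d = 0]. *)
pose s i := h i.+1 i.
have sE k : restr (d + k) s = restr (d + k) (h k).
  apply/restr_eq => i ik; rewrite /s; have [ki|ki] := leqP k i.+1.
    by have /restr_eq := hE _ _ ki; exact.
  have /restr_eq -> // := hE _ _ (ltnW ki).
  by rewrite addnS ltnS leq_addl.
have sEi k i : (i < d + k)%N -> s i = h k i by have /restr_eq := sE k; exact.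
have st : tight s.
  move=> n; rewrite (@sEi n.+1) ?(@sEi n.+2 n.+1); [|lia|lia].
  rewrite -(@sEi n.+1) ?(@sEi n.+2); [|lia|lia].
  exact: ht.
have rs k : reduct s (h k).
  move=> i; rewrite /s; have [ki|ki] := leqP k i.+1; first exact: hr.
  have -> : h i.+1 i = h k i by rewrite -(@sEi k) //; lia.
  exact: generated_id.
exists s.
  split=> //; first exact: (reduct_trans st u0t t0t (rs 0)).
  by have := sE 0; rewrite addn0 => ->.
move=> k u [ut ru Eu] dk.
suff [n dn kn] : exists2 n, (d <= n)%N & ends_at (restr k u) n s.
  have E : restr n s = restr n (h (n - d)).
    by have := sE (n - d)%N; rewrite subnKC.
  have [_ _ /(_ (restr k u))] := hS (n - d)%N; rewrite subnKC// => Pk.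
  apply: (Pher _ _ _ (ht (n - d).+1) st _ (Pk _)).
    move=> v [vt rv Ev]; split=> //.
    by apply: (reduct_trans vt st _ rv (rs _)); exact: ht.
  exact: (ends_at_restr st (ht _) E kn).
have [k0|k0] := posnP k.
  exists 0; first by rewrite -k0.
  by exists s; rewrite k0; split=> //; exact: reduct_refl.
have [n [v [vN uk]]] := ru k.
have Enk : (u k).1 = (s n).1 by rewrite uk.
have dn : (d <= n)%N.
  have [->//|d0] := posnP d.
  rewrite -(start_leq_mono st) -Enk.
  have <- : (u d).1 = (s d).1.
    apply: (start_restr ut st _ d0); rewrite Eu.
    by have := sE 0; rewrite addn0 => ->.
  by rewrite (start_leq_mono ut).
exists n => //; exists u; rewrite size_restr; split=> //.
(* A nonempty approximation cannot end at [n = 0], because [u k] starts strictly after [u 0], which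
   starts no earlier than [s 0]. *)
rewrite (gtn_eqF k0); apply/esym/negbTE/eqP => n0.
have := generated_ge st (ru 0); rewrite n0 in Enk.
by rewrite -Enk (start_leq_mono ut) leqNgt k0.
Qed.

(** Since [a] is nonempty, all blocks that can follow it start at the same place. Colouring them
    amounts to colouring coefficient words over the tail of [u0]. *)
Lemma pigeonhole_nonempty (Q : set code) a t : (0 < size a)%N -> tight t ->
  nbd tight reduct a t !=set0 -> exists2 s, nbd tight reduct a t s &
    (forall u, nbd tight reduct a s u -> Q (u (size a))) \/
    (forall u, nbd tight reduct a s u -> ~ Q (u (size a))).
Proof.
move=> d0 tt [u0 [u0t u0r Ea]]; set d := size a in d0 Ea *.
have [V [VN VQ]] := carlson [set v | Q ((u0 d).1, act (words u0) d v)].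
(* [off k] counts the blocks of [u0], from index [d] on, that are used up by [V 0], ...,
   [V k.-1]. *)
pose off := fix off k := if k is k'.+1 then (off k' + size (V k'))%N else 0.
pose s1 k := ((u0 (d + off k)).1, act (words u0) (d + off k) (V k)) : code.
have act_s1 i v : act (words s1) i v = act (words u0) (d + off i) (act V i v).
  elim: v i => //= y v IH i; rewrite act_cat size_subst subst_act.
  by rewrite IH /= addnA.
have s1t : tight s1.
  move=> k; split; first by rewrite None_act// => n; exact: tight_None.
  by rewrite /stop /s1 /= stop_act// addnA.
have s1r : reduct s1 u0 by move=> k; exists (d + off k)%N, (V k); split.
have s10 : (s1 0).1 = (u0 d).1 by rewrite /s1 /= addn0.
pose s := join u0 d 0 s1.
have st : tight s by exact: tight_join.
have su0 : reduct s u0 by apply: reduct_join => //; exact: reduct_refl.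
have Es : restr d s = restr d u0 by exact: restr_join.
have ud u : nbd tight reduct a s u -> exists2 v, None \in v &
    u d = ((u0 d).1, act (words u0) d (act V 0 v)).
  move=> [ut ru Eu]; have [i [v [vN udE]]] := ru d.
  have id_ : i = d.
    apply: (start_inj st); have <- : (u d).1 = (s d).1.
      by apply: (start_restr ut st) => //; rewrite Es Ea Eu.
    by rewrite udE.
  exists v => //; rewrite udE id_ join_start s10; congr (_, _).
  rewrite (@eq_act _ (words s) (words s1) d 0) ?act_s1 /= ?addn0//.
  by move=> k _; rewrite /s joinr.
exists s; first by split=> //; [exact: (reduct_trans st u0t tt)|rewrite Es].
by case: VQ => VQ; [left|right] => u /ud[v vN ->]; exact: VQ.
Qed.

Lemma pigeonhole_empty (Q : set code) t : tight t -> exists2 s,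
  nbd tight reduct [::] t s &
    (forall u, nbd tight reduct [::] s u -> Q (u 0)) \/
    (forall u, nbd tight reduct [::] s u -> ~ Q (u 0)).
Proof.
move=> tt.
pose P b t := (0 < size b)%N ->
    (forall u, nbd tight reduct b t u -> Q (u (size b))) \/
    (forall u, nbd tight reduct b t u -> ~ Q (u (size b))).
have [|||s [st rs _] sP] := @code_fusion P _ _ [::] t tt.
- move=> b u u' ut u't u'u Pb b0.
  by case: (Pb b0) => H; [left|right] => v /u'u; exact: H.
- move=> b u ut bu; have [b0|b0] := posnP (size b).
    by have [v bv] := bu; exists v => //; rewrite /P b0.
  by have [v bv Pv] := pigeonhole_nonempty Q b0 ut bu; exists v.
- by exists t; split=> //; exact: reduct_refl.
(* Every generated block starting at [s n] extends the first [n] blocks of [s], so fusion has made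
   its colour depend on [n] alone. *)
have homog n : (0 < n)%N ->
    (forall x, generated s x -> x.1 = (s n).1 -> Q x) \/
    (forall x, generated s x -> x.1 = (s n).1 -> ~ Q x).
  move=> n0; have : P (restr n s) s by apply: sP => //; split=> //; exact: reduct_refl.
  rewrite /P size_restr => /(_ n0).
  suff H x : generated s x -> x.1 = (s n).1 ->
      exists2 u, nbd tight reduct (restr n s) s u & u n = x.
    by case=> HQ; [left|right] => x sx /(H _ sx)[u /HQ + <-].
  move=> sx xn; have [m xm] := generated_stop st sx.
  pose xs i := if i is i'.+1 then s (m + i')%N else x.
  have xst : tight xs.
    case=> [|i] /=; first by rewrite addn0; split=> //; exact: generated_None sx.
    by rewrite addnS.
  exists (join s n 0 xs); last by have := joinr s n 0 xs 0; rewrite addn0.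
  split; first exact: tight_join.
    apply: reduct_join => [|[|i]//]; [exact: reduct_refl|exact: generated_id].
  by rewrite size_restr restr_join.
suff [s' [s't rs' Es']] : exists s', [/\ tight s', reduct s' s &
    (forall k x, generated s x -> x.1 = (s' k).1 -> Q x) \/
    (forall k x, generated s x -> x.1 = (s' k).1 -> ~ Q x)].
  exists s'; first by split=> //; exact: (reduct_trans s't st tt).
  have u0 u : nbd tight reduct [::] s' u ->
      generated s (u 0) /\ exists k, (u 0).1 = (s' k).1.
    move=> [ut ru _]; split; first exact: (reduct_generated s't st).
    by have [k [v [_ ->]]] := ru 0; exists k.
  by case: Es' => HQ; [left|right] => u /u0[su [k uk]]; exact: (HQ k).
pose good n := forall x, generated s x -> x.1 = (s n).1 -> Q x.
have [inf|] := pselect (forall m, exists2 n, (m <= n)%N & good n).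
  have /choice[g gP] : forall m, exists n, (m <= n)%N /\ good n.
    by move=> m; have [n] := inf m; exists n.
  (* When good starts are unbounded, the blocks between chosen ones are merged with all coefficients
     the variable, leaving only good starts. *)
  pose idx := fix idx k := if k is k'.+1 then g (idx k').+1 else g 0.
  have idxS k : (idx k < idx k.+1)%N by case: (gP (idx k).+1).
  have idx_good k : good (idx k) by case: k => [|k]; [have [] := gP 0|have [] := gP (idx k).+1].
  exists (fun k => ((s (idx k)).1,
    act (words s) (idx k) (nseq (idx k.+1 - idx k) None))).
  have blockN k : None \in nseq (idx k.+1 - idx k) (@None L).
    by rewrite mem_nseq subn_gt0 idxS eqxx.
  split; [move=> k|move=> k|left=> k x sx xk].
  - split; first by rewrite None_act// => n; exact: tight_None.
    by rewrite /stop /= stop_act// size_nseq subnKC// ltnW// idxS.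
  - by eexists; eexists; split; last reflexivity.
  - exact: (idx_good k).
(* Otherwise no start from [m] on is good. The tail begins at [m.+1] so that all its indices are
   positive, as [homog] requires. *)
move=> /existsNP[m nm]; exists (fun k => s (m.+1 + k)%N); split.
- by move=> k; rewrite addnS.
- by move=> k; exact: generated_id.
- right=> k x sx xk; have [//|gk|HQ] := homog (m.+1 + k)%N; last exact: (HQ x).
  exfalso; apply: nm; exists (m.+1 + k)%N => //.
  by rewrite addSn -addnS leq_addr.
Qed.

Lemma code_pigeonhole : pigeonhole_property tight reduct.
Proof.
move=> Q [|y a] t tt at0; first exact: pigeonhole_empty.
exact: pigeonhole_nonempty.
Qed.

End CodeSpace.

(** * The abstract Ellentuck theorem *)

Section AbstractEllentuck.
Context (T : Type) (R : set (nat -> T)).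
Context (le : (nat -> T) -> (nat -> T) -> Prop).
Hypothesis le_quasi_order : quasi_order_on R le.
Local Notation nbd := (nbd R le).
Implicit Types (a b : seq T) (s t u v : nat -> T) (X : set (nat -> T)).

Lemma nbd_R a t s : nbd a t s -> R s.
Proof. by case. Qed.

Lemma nbd_id k t : R t -> nbd (restr k t) t t.
Proof. by move=> Rt; split; rewrite ?size_restr//; exact: le_quasi_order.1. Qed.

Lemma nbd_self a t s : nbd a t s -> nbd a s s.
Proof. by case=> Rs _ <-; exact: nbd_id. Qed.

Lemma nbd_sub a b t s : R t -> nbd b t s -> nbd a s `<=` nbd a t.
Proof.
move=> Rt [Rs st _] u [Ru us Eu]; split=> //.
exact: (le_quasi_order.2 _ _ _ Ru Rs Rt us st).
Qed.

Lemma nbd_restr a t t' u k : nbd a t u -> (size a <= k)%N ->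
  nbd (restr k u) t' `<=` nbd a t'.
Proof.
move=> [_ _ Eu] ak v [Rv vt']; rewrite size_restr => Ev; split=> //.
rewrite -[RHS]Eu; apply/restr_eq => i ia.
by have /restr_eq := Ev; apply; exact: leq_trans ak.
Qed.

Lemma restrS k u : restr k.+1 u = rcons (restr k u) (u k).
Proof. exact: mkseqS. Qed.

Hypothesis fusion : fusion_property R le.
Hypothesis pigeonhole : pigeonhole_property R le.

Lemma fusion_decide X a t : R t -> nbd a t !=set0 -> exists2 s, nbd a t s &
  forall k u, nbd a s u -> (size a <= k)%N -> nbd (restr k u) s `<=` X \/
    forall v, nbd (restr k u) s v -> ~ nbd (restr k u) v `<=` X.
Proof.
apply: (fusion (P := fun b t => nbd b t `<=` X \/
  forall v, nbd b t v -> ~ nbd b v `<=` X)).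
- move=> b u u' Ru Ru' u'u [uX|uX]; [left|right].
    exact: subset_trans uX.
  by move=> v /u'u; exact: uX.
- move=> b u Ru [w bw].
  have [[v bv vX]|nv] := pselect (exists2 v, nbd b u v & nbd b v `<=` X).
    by exists v => //; left.
  exists w => //; right=> v bv vX; apply: nv; exists v => //.
  exact: (nbd_sub Ru bw).
Qed.

(* Nash-Williams combinatorial forcing: if no [v] in [nbd a s] has
   [nbd a v `<=` X], this rejection propagates to all longer approximations. *)
Lemma open_ramsey X :
  (forall s, R s -> X s -> exists k, nbd (restr k s) s `<=` X) ->
  forall a t, R t -> nbd a t !=set0 -> exists2 s, nbd a t s &
    nbd a s `<=` X \/ (forall u, nbd a s u -> ~ X u).
Proof.
move=> Xopen a t Rt at0.
(* Either [b] is accepted or all its one-block extensions are rejected. For density, the extensions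
   are first decided, then pigeonhole makes them all accepted or all not. *)
pose P b t := nbd b t `<=` X \/ forall u, nbd b t u ->
  forall v, nbd (restr (size b).+1 u) t v -> ~ nbd (restr (size b).+1 u) v `<=` X.
have [||s sat sP] := @fusion P _ _ a t Rt at0.
- move=> b u u' Ru Ru' u'u [uX|uX]; [left|right].
    exact: subset_trans uX.
  move=> w u'w v wv; apply: (uX _ (u'u _ u'w)).
  have [_ vu _] := u'u _ (nbd_restr u'w (leqnSn _) wv).
  by case: wv => Rv _ Ev; split.
- move=> b u Ru /(fusion_decide X Ru)[s1 us1 s1P].
  have Rs1 := nbd_R us1.
  have [|s2 bs2 s2Q] := pigeonhole [set x | nbd (rcons b x) s1 `<=` X] Rs1 (a := b).
    by exists s1; exact: nbd_self us1.
  have restrb w : nbd b s2 w -> restr (size b).+1 w = rcons b (w (size b)).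
    by move=> [_ _ Ew]; rewrite restrS Ew.
  exists s2; first exact: (nbd_sub Ru us1).
  case: s2Q => s2Q; [left=> w bw|right=> w bw v wv vX].
    apply: (s2Q _ bw); rewrite -restrb//; apply: (nbd_sub Rs1 bs2).
    by case: bw => Rw ws2 Ew; split; rewrite ?size_restr.
  have [] := s1P (size b).+1 w (nbd_sub Rs1 bs2 bw) (leqnSn _).
    by rewrite restrb//; exact: s2Q.
  by move=> /(_ v (nbd_sub Rs1 bs2 wv)); exact.
have Rs := nbd_R sat; have Es : restr (size a) s = a by case: sat.
have [[v av vX]|rej_a] := pselect (exists2 v, nbd a s v & nbd a v `<=` X).
  by exists v; [exact: (nbd_sub Rt sat)|left].
have rej k : (size a <= k)%N -> forall u, nbd a s u ->
    forall v, nbd (restr k u) s v -> ~ nbd (restr k u) v `<=` X.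
  move=> /subnKC <-; elim: (k - size a)%N => [|m IH] u au v.
    have [_ _ Eu] := au; rewrite addn0 Eu => av vX.
    by apply: rej_a; exists v.
  have [bX|] := sP (size a + m)%N u au (leq_addr _ _); last first.
    rewrite size_restr -addnS; apply.
    by case: au => Ru us _; split; rewrite ?size_restr.
  exfalso; apply: (IH u au u).
    by case: au => Ru us _; split; rewrite ?size_restr.
  apply: subset_trans bX; apply: (nbd_sub Rs au).
(* A point of [X] accepts one of its own approximations, as [X] is open; at length [K] this
   contradicts rejection. *)
exists s => //; right=> u au Xu; have Ru := nbd_R au.
have [k kX] := Xopen u Ru Xu; pose K := maxn k (size a).
apply: (rej K (leq_maxr _ _) u au u).
  by case: au => _ us _; split; rewrite ?size_restr.
apply: subset_trans kX.
by apply: (nbd_restr (nbd_id k Ru)); rewrite size_restr leq_maxl.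
Qed.

Definition ramsey_null X : Prop := forall a t, R t -> nbd a t !=set0 ->
  exists2 s, nbd a t s & forall u, nbd a s u -> ~ X u.

(** [Y] is the interior of the complement of [X]. The open set [Y] is Ramsey, and its density
    excludes a neighbourhood that misses it. *)
Lemma nowhere_dense_ramsey_null X :
  (forall k t, R t -> exists2 u, nbd (restr k t) t u &
     exists j, forall v, nbd (restr j u) u v -> ~ X v) ->
  ramsey_null X.
Proof.
move=> Xnd a t Rt at0.
pose Y := [set s | R s /\ exists k, forall v, nbd (restr k s) s v -> ~ X v].
have [|s sat [sY|sY]] := @open_ramsey Y _ a t Rt at0.
- move=> s Rs [_ [k kX]]; exists k => u su; have Ru := nbd_R su.
  split=> //; exists k => v uv; apply: kX; apply: (nbd_sub Rs su).
  by have := nbd_restr su (t' := u) (k := k); rewrite size_restr; exact.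
- exists s => // u /sY[Ru [k kX]]; exact: kX (nbd_id k Ru).
- have [_ _ Es] := nbd_self sat.
  have [u su [j jX]] := Xnd (size a) s (nbd_R sat); rewrite Es in su.
  by exfalso; apply: (sY u su); split; [exact: nbd_R su|exists j].
Qed.

(** An approximation of length [k] has to avoid only the sets with index at most [k]; a point of
    [F n] is caught at length [maxn n (size a)]. *)
Lemma ramsey_null_bigcup (F : nat -> set (nat -> T)) :
  (forall n, ramsey_null (F n)) -> ramsey_null (\bigcup_n F n).
Proof.
move=> Fnull a t Rt at0.
pose P b t := forall i, (i <= size b)%N -> forall u, nbd b t u -> ~ F i u.
have [||s sat sP] := @fusion P _ _ a t Rt at0.
- by move=> b u u' Ru Ru' u'u uP i ib w /u'u; exact: uP.
- move=> b u Ru bu0.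
  suff [s bs sF] : exists2 s, nbd b u s & forall i, (i < (size b).+1)%N ->
      forall v, nbd b s v -> ~ F i v by exists s.
  elim: (size b).+1 => [|m [s1 bs1 s1F]].
    by have [s bs] := bu0; exists s.
  have Rs1 := nbd_R bs1.
  have [|s2 bs2 s2F] := Fnull m b s1 Rs1; first by exists s1; exact: nbd_self bs1.
  exists s2; first exact: (nbd_sub Ru bs1).
  move=> i; rewrite ltnS leq_eqVlt => /predU1P[->//|im] v /(nbd_sub Rs1 bs2).
  exact: s1F.
exists s => // u su [n _ Fu]; have Ru := nbd_R su; pose k := maxn n (size a).
apply: (sP k u su (leq_maxr _ _) n _ u _ Fu); first by rewrite size_restr leq_maxl.
by case: su => _ us _; split; rewrite ?size_restr.
Qed.

Notation space := (ellentuck R le).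
Implicit Types (e f : space) (U V : set space).

Definition pull U : set (nat -> T) := [set s | exists2 e, U e & set_val e = s].

Lemma set_val_R e : R (set_val e).
Proof. exact: set_valP. Qed.

Lemma set_val_surj s : R s -> exists e : space, set_val e = s.
Proof. by move=> Rs; exists (SigSub (mem_set Rs)). Qed.

Lemma pullE U e : pull U (set_val e) <-> U e.
Proof.
split=> [[f Uf /val_inj <-]//|Ue]; by exists e.
Qed.

Lemma basic_setE a e f : basic_set a e f <-> nbd a (set_val e) (set_val f).
Proof.
split=> [[fe [k Ef]]|[_ fe Ef]]; last by split=> //; exists (size a).
by split=> //; [exact: set_val_R|rewrite -Ef size_restr].
Qed.

Lemma basic_set_open a e : approximations R a -> open (basic_set a e).
Proof.
move=> Ra; exists [set basic_set a e]; last by rewrite bigcup_set1.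
by move=> _ ->; apply: (finI_from1 id); exists a, e.
Qed.

(** An open set is a union of finite intersections of basic sets; cutting [e] at the longest
    approximation involved gives a single basic set inside. *)
Lemma open_basic_set U e : open U -> U e ->
  exists k, basic_set (restr k (set_val e)) e `<=` U.
Proof.
move=> [D' D'fin <-] [B D'B Be].
have {D'fin}[N NB BN] : exists2 N : seq (set space),
    forall C, C \in N -> exists a f, C = basic_set a f &
    forall g, (forall C, C \in N -> C g) <-> (B : set space) g.
  have [N ND <-] := D'fin _ D'B; exists (enum_fset N) => // C CN.
  by have /set_mem[a [f [_ ->]]] := ND _ CN; exists a, f.
have /choice[kf kfP] : forall C, exists k, C \in N ->
    basic_set (restr k (set_val e)) e `<=` C.
  move=> C; have [CN|] := boolP (C \in N); last by exists 0.
  have [a [f EC]] := NB _ CN.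
  have /basic_setE ef : basic_set a f e by rewrite -EC; exact: (BN e).2.
  have [_ _ Ea] := ef.
  exists (size a) => _ g; rewrite Ea EC => /basic_setE eg; apply/basic_setE.
  exact: (nbd_sub (set_val_R f) ef).
exists (\max_(C <- N) kf C) => g /basic_setE eg; exists B => //.
apply/BN => C CN; apply: (kfP _ CN); apply/basic_setE.
apply: (nbd_restr (nbd_id (kf C) (set_val_R e))) eg.
by rewrite size_restr; apply: leq_bigmax_seq.
Qed.

Lemma meager_pull_null U : meager U -> ramsey_null (pull U).
Proof.
move=> [F [Fnd ->]].
have -> : pull (\bigcup_n F n) = \bigcup_n pull (F n).
  apply/seteqP; split=> [s [e [n _ Fe] <-]|s [n _ [e Fe <-]]].
    by exists n => //; exists e.
  by exists e => //; exists n.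
apply: ramsey_null_bigcup => n; apply: nowhere_dense_ramsey_null => k t Rt.
have [e et] := set_val_surj Rt; subst t.
have openB : open (basic_set (restr k (set_val e)) e).
  by apply: basic_set_open; exists k, (set_val e); split=> //; exact: set_val_R.
have [f ef nf] : exists2 f, basic_set (restr k (set_val e)) e f &
    ~ closure (F n) f.
  apply: contrapT => H.
  suff : interior (closure (F n)) e by rewrite Fnd.
  rewrite interiorEbigcup; exists (basic_set (restr k (set_val e)) e).
    split=> // f ef; apply: contrapT => nf; apply: H; by exists f.
  by apply/basic_setE; exact: nbd_id (set_val_R e).
exists (set_val f); first exact/basic_setE.
have [j jP] := @open_basic_set (~` closure (F n)) f
  (closed_openC (@closed_closure _ _)) nf.
exists j => v fv [g Fg gv]; subst v.
by apply: (jP g); [exact/basic_setE|exact: subset_closure].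
Qed.

(** For a set differing from the open [V] by the meager [M], one first shrinks to avoid [M] and then
    makes [V] homogeneous; there the set agrees with [V]. *)
Lemma ellentuck_theorem : topological_Ramsey_space R le.
Proof.
split=> [//|U [V [M [Vopen Mm ->]]] a e _ [f0 /basic_setE ef0]|
  U /meager_pull_null Unull a e _ [f0 /basic_setE ef0]].
- have Re := set_val_R e.
  have [|s1 es1 s1M] := meager_pull_null Mm Re (a := a); first by exists (set_val f0).
  have Rs1 := nbd_R es1.
  have [||s2 es2 s2V] := @open_ramsey (pull V) _ a s1 Rs1.
  + move=> _ _ [g Vg <-]; have [k kV] := open_basic_set Vopen Vg.
    exists k => v gv; have [g' g'v] := set_val_surj (nbd_R gv); subst v.
    by apply/pullE; apply: kV; exact/basic_setE.
  + by exists s1; exact: nbd_self es1.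
  have [g gs2] := set_val_surj (nbd_R es2); subst s2.
  exists g; first by apply/basic_setE; exact: (nbd_sub Re es1).
  have notM h : basic_set a g h -> ~ M h.
    move=> /basic_setE gh Mh; apply: (s1M (set_val h)); last exact/pullE.
    exact: (nbd_sub Rs1 es2).
  case: s2V => s2V; [left=> h gh|right; apply/seteqP; split=> // h [gh]].
    left; split; last exact: notM.
    by apply/pullE; apply: s2V; exact/basic_setE.
  case=> [[Vh _]|[Mh _]]; last exact: (notM h).
  by apply: (s2V (set_val h)); [exact/basic_setE|exact/pullE].
- have [|s es sU] := Unull a (set_val e) (set_val_R e); first by exists (set_val f0).
  have [g gs] := set_val_surj (nbd_R es); subst s.
  exists g; first exact/basic_setE.
  apply/seteqP; split=> // h [/basic_setE gh Uh].
  by apply: (sU _ gh); exact/pullE.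
Qed.

End AbstractEllentuck.

(** * Creatures as variable words *)

Section FiniteMaps.
Local Open Scope fset_scope.
Local Open Scope fmap_scope.

Lemma domfE (V : Type) (f : {fmap nat -> V}) i : (i \in domf f) = (f.[? i] : bool).
Proof. by case: fndP. Qed.

Lemma fnd_values (V : Type) (f : {fmap nat -> V}) (P : V -> Prop) :
  (forall i (fi : i \in domf f), P (f.[fi])) <->
  (forall i c, f.[? i] = Some c -> P c).
Proof.
split=> [fP i c|fP i fi]; last by apply: (fP i); rewrite in_fnd.
by case: fndP => // fi [<-]; exact: fP.
Qed.

Lemma fnd_fmap (V : Type) (A : {fset nat}) (g : nat -> V) i :
  [fmap j : A => g (val j)].[? i] = if i \in A then Some (g i) else None.
Proof.
by case: fndP => // iA; rewrite ffunE.
Qed.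

Lemma in_interval m n i : (i \in interval_fset m n) = (m <= i < n)%N.
Proof. by rewrite !inE mem_index_iota. Qed.

End FiniteMaps.

Section Creatures.
Local Open Scope fset_scope.
Local Open Scope fmap_scope.
Context (R : realType) (N : nat).
Notation letter := (option 'I_N).
Notation code := (code 'I_N).
Notation creature := (N_creature R).
Implicit Types (x y : code) (t : creature) (f : {fmap nat -> nat}).

Definition letter_at x i : letter := nth None x.2 (i - x.1).
Definition letter_value : letter -> option nat := omap (@nat_of_ord N).

Lemma letter_value_inj : injective letter_value.
Proof. by move=> [a|] [b|] //= [/val_inj ->]. Qed.

Notation within x i := (x.1 <= i < stop x)%N.

Definition code_phi x : {fmap nat -> nat} :=
  [fmap i : [fset i in index_iota x.1 (stop x) | letter_at x i != None] =>
     odflt 0 (letter_value (letter_at x (val i)))].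

Lemma code_phiE x i : (code_phi x).[? i] =
  if within x i then letter_value (letter_at x i) else None.
Proof.
rewrite (fnd_fmap _ (fun i => odflt 0 (letter_value (letter_at x i)))).
rewrite !inE mem_index_iota; case: ifP => /= [/andP[-> ]|].
  by case: letter_at.
by case: ifP => //= _; case: letter_at.
Qed.

Definition fill x c : {fmap nat -> nat} :=
  [fmap i : interval_fset x.1 (stop x) =>
     odflt c (letter_value (letter_at x (val i)))].

Lemma fillE x c i : (fill x c).[? i] =
  if within x i then Some (odflt c (letter_value (letter_at x i))) else None.
Proof.
rewrite (fnd_fmap _ (fun i => odflt c (letter_value (letter_at x i)))).
by rewrite in_interval.
Qed.

Definition creature_of x : creature := Creature (stop x)%:R%R
  [fset fill x c | c in iota 0 N] (domf (code_phi x), code_phi x) x.1 (stop x).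

Lemma block_creature_of x i : (i \in block (creature_of x)) = within x i.
Proof. exact: in_interval. Qed.

Lemma X_of_creature_of x i :
  (i \in X_of (creature_of x)) = (code_phi x).[? i] :> bool.
Proof. exact: domfE. Qed.

(** Because [X_of t] is a proper subset of the block, some place [i0] carries the constant [c],
    which is therefore below [N]. *)
Lemma val_spec t f : (X_of t `<` block t) -> domf (phi_of t) = X_of t ->
  (forall i c, (phi_of t).[? i] = Some c -> (c < N)%N) ->
  [/\ domf f = block t,
     forall i (fi : i \in domf f), (f.[fi] < N)%N,
     f.[& X_of t] = phi_of t &
     exists c, forall i, i \in (block t `\` X_of t) -> f.[? i] = Some c] <->
  exists2 c, (c < N)%N & forall i, f.[? i] =
    if i \in block t then Some (odflt c (phi_of t).[? i]) else None.
Proof.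
rewrite fproperE => /andP[/fsubsetP XB /fsubsetPn[i0 i0B i0X]] domX phiN.
have phiX i : (i \in X_of t) = (phi_of t).[? i] :> bool by rewrite -domX domfE.
split=> [[domB /(fnd_values _ (fun c => (c < N)%N)) fN fX [c fc]]|[c cN fE]].
  have fi0 : f.[? i0] = Some c by apply: fc; rewrite in_fsetD i0X.
  exists c; first exact: (fN _ _ fi0).
  move=> i; case: ifP => iB; last first.
    by have /not_fnd : i \notin domf f by rewrite domB iB.
  have [iX|iX] := boolP (i \in X_of t).
    have := fnd_restrict f (X_of t) i; rewrite iX fX => <-.
    by move: iX; rewrite phiX; case: (_.[? i]).
  have -> : f.[? i] = Some c by apply: fc; rewrite in_fsetD iX.
  by move: iX; rewrite phiX; case: (_.[? i]).
split.
- by apply/fsetP => i; rewrite domfE fE; case: ifP.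
- apply/(fnd_values _ (fun c => (c < N)%N)) => i d; rewrite fE.
  case: ifP => // _ [<-]; case E: (_.[? i]) => [e|]//=; exact: phiN E.
- apply/fmapP => i; rewrite fnd_restrict fE phiX.
  have [iX|] := boolP ((phi_of t).[? i] : bool).
    by rewrite XB ?phiX//; case: (_.[? i]) iX.
  by case: (_.[? i]).
- exists c => i; rewrite in_fsetD phiX fE => /andP[iX ->].
  by case: (_.[? i]) iX.
Qed.

Lemma letter_value_lt (l : letter) c : letter_value l = Some c -> (c < N)%N.
Proof. by case: l => //= a [<-]. Qed.

Lemma creature_of_proper x : None \in x.2 ->
  X_of (creature_of x) `<` block (creature_of x).
Proof.
move=> /(nthP None)[k kx xk]; rewrite fproperE; apply/andP; split.
  apply/fsubsetP => i; rewrite X_of_creature_of code_phiE block_creature_of.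
  by case: ifP.
apply/fsubsetPn; exists (x.1 + k)%N.
  by rewrite block_creature_of leq_addr ltn_add2l.
by rewrite X_of_creature_of code_phiE /letter_at addKn xk; case: ifP.
Qed.

Lemma creature_of_phi_lt x i c : (code_phi x).[? i] = Some c -> (c < N)%N.
Proof. by rewrite code_phiE; case: ifP => // _; exact: letter_value_lt. Qed.

Lemma val_creature_of x f : f \in val_of (creature_of x) <->
  exists2 c, (c < N)%N & forall i, f.[? i] =
    if i \in block (creature_of x) then Some (odflt c (code_phi x).[? i]) else None.
Proof.
have fillE' c i : (fill x c).[? i] = if i \in block (creature_of x)
    then Some (odflt c (code_phi x).[? i]) else None.
  by rewrite fillE block_creature_of code_phiE; case: ifP.
split=> [/imfsetP[c /= + ->]|[c cN fE]].
  by rewrite mem_iota => cN; exists c.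
apply/imfsetP; exists c; first by rewrite /= mem_iota.
by apply/fmapP => i; rewrite fE fillE'.
Qed.

Lemma K_N_creature_of x : (0 < N)%N -> None \in x.2 -> K_N R N (creature_of x).
Proof.
move=> N_gt0 xN; have x0 : (0 < size x.2)%N by case: x.2 xN.
have domV f : f \in val_of (creature_of x) -> domf f = block (creature_of x).
  move=> /val_creature_of[c cN fE]; apply/fsetP => i.
  by rewrite domfE fE; case: ifP.
split.
  split.
  - by rewrite /=; exact: Num.Theory.ler0n.
  - by rewrite /= /stop -[ltnLHS]addn0 ltn_add2l.
  - apply/fset0Pn; exists (fill x 0); apply/imfsetP; exists 0 => //=.
    by rewrite mem_iota.
  - move=> f fV; split.
      rewrite domV//; apply/fset0Pn; exists x.1.
      by rewrite block_creature_of leqnn /= /stop -[ltnLHS]addn0 ltn_add2l.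
    move: fV => /val_creature_of[c cN fE].
    move=> i fi; rewrite /H_N in_interval /=; move: i fi.
    apply/(fnd_values _ (fun c => (c < N)%N)) => i d; rewrite fE.
    case: ifP => // _ [<-]; case E: (_.[? i]) => [e|]//=.
    exact: creature_of_phi_lt E.
  - by move=> f /domV ->.
split=> //; first exact: creature_of_proper.
  split=> //; apply/(fnd_values _ (fun c => (c < N)%N)); exact: creature_of_phi_lt.
move=> f; rewrite val_creature_of val_spec//; first exact: creature_of_proper.
exact: creature_of_phi_lt.
Qed.

(** The components [nor] and [val_of] are determined by the interval and [phi_of t], so it suffices
    to read off the word: a letter where [phi_of t] is defined, the variable elsewhere. *)
Lemma K_N_surj t : K_N R N t -> exists2 x, None \in x.2 & t = creature_of x.
Proof.
move=> [[_ dnup _ _ _] [XB [domX /(fnd_values _ (fun c => (c < N)%N)) phiN] tnor tval]].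
pose w : seq letter :=
  [seq obind insub (phi_of t).[? i] | i <- index_iota (m_dn t) (m_up t)].
pose x : code := (m_dn t, w).
have sx : stop x = m_up t.
  by rewrite /stop /= size_map size_iota subnKC// ltnW.
have xE i : within x i -> letter_value (letter_at x i) = (phi_of t).[? i].
  rewrite sx /= => /andP[di iu]; rewrite /letter_at /= (nth_map 0); last first.
    by rewrite size_iota; lia.
  rewrite nth_iota; last by lia.
  rewrite subnKC//; case E: (_.[? i]) => [c|]//=.
  by rewrite insubT ?(phiN _ _ E).
have [/fsubsetP XsB /fsubsetPn[i0 i0B i0X]] : X_of t `<=` block t /\
    ~~ (block t `<=` X_of t) by apply/andP; rewrite -fproperE.
have phix : code_phi x = phi_of t.
  apply/fmapP => i; rewrite code_phiE; case: ifP => ix; first exact: xE.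
  have /not_fnd -> // : i \notin domf (phi_of t).
  by rewrite domX; apply/negP => /XsB; rewrite in_interval -sx ix.
exists x.
  move: i0B; rewrite in_interval -sx => i0x; have := xE _ i0x.
  move: i0X; rewrite -domX domfE; case: (_.[? i0]) => // _.
  case E: letter_at => // _; rewrite -E; apply: mem_nth.
  by case/andP: i0x => di iu; rewrite -(ltn_add2l x.1) subnKC.
have valE f : f \in val_of t <-> f \in val_of (creature_of x).
  rewrite tval val_spec// val_creature_of phix.
  by rewrite /block /= sx.
rewrite /creature_of phix sx domX /=.
case: t @w @x sx xE XB domX phiN tnor tval dnup i0 i0B i0X XsB phix valE.
move=> n V [X phi] dn up w x sx _ _ _ _ /= -> _ _ _ _ _ _ _ valE.
congr Creature; apply/fsetP => f; apply/idP/idP => /valE //.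
Qed.

Lemma creature_of_inj x y : creature_of x = creature_of y -> x = y.
Proof.
move=> E; have E1 : x.1 = y.1 := congr1 (@m_dn _ _ _) E.
have Es : stop x = stop y := congr1 (@m_up _ _ _) E.
have Ep : code_phi x = code_phi y := congr1 (fun t => phi_of t) E.
case: x y E1 Es Ep {E} => [p w] [q v] /= pq; subst q.
rewrite /stop /= => /addnI swv Ep; congr (_, _).
apply: (@eq_from_nth _ None) => // k kw.
have := congr1 (fun f => f.[? (p + k)%N]) Ep; rewrite !code_phiE /stop /= -swv.
rewrite leq_addr ltn_add2l kw /= /letter_at /= addKn.
exact: letter_value_inj.
Qed.

Notation words d := (fun k => (d k).2).
Notation overwrite l y := (if l is Some _ then l else y).

(** The two alternatives of [Sigma_N]: the variable of [u] is kept for [y = None], and replaced by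
    the constant of a member of [val_of] for a letter [y]. *)
Lemma substitution_spec x u : (forall i, within u i -> within x i) ->
  ((X_of (creature_of x) `&` block (creature_of u) = X_of (creature_of u) /\
    (phi_of (creature_of x)).[& block (creature_of u)] =
      phi_of (creature_of u)) \/
   (block (creature_of u) `<=` X_of (creature_of x) /\
    (phi_of (creature_of x)).[& block (creature_of u)] \in
      val_of (creature_of u))) <->
  exists y : letter, forall i, within u i ->
    letter_at x i = overwrite (letter_at u i) y.
Proof.
move=> ux; split.
- case=> [[_ /fmapP E]|[_ /val_creature_of[c cN E]]].
    exists None => i iu; apply: letter_value_inj.
    have := E i; rewrite fnd_restrict block_creature_of iu.
    by rewrite !code_phiE iu ux// => ->; case: letter_at.
  exists (Some (Ordinal cN)) => i iu; apply: letter_value_inj.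
  have := E i; rewrite fnd_restrict block_creature_of iu.
  by rewrite !code_phiE iu ux// => ->; case: letter_at.
- move=> [[a|] E]; [right|left]; split.
  + apply/fsubsetP => i; rewrite block_creature_of X_of_creature_of => iu.
    by rewrite code_phiE ux// E//; case: letter_at.
  + apply/val_creature_of; exists (val a) => [|i]; first exact: ltn_ord.
    rewrite fnd_restrict block_creature_of; case: ifP => // iu.
    by rewrite !code_phiE iu ux// E//; case: letter_at.
  + apply/fsetP => i; rewrite in_fsetI !X_of_creature_of block_creature_of.
    rewrite !code_phiE; case: (boolP (within u i)) => iu; last by rewrite andbF.
    by rewrite ux// E// andbT; case: letter_at.
  + apply/fmapP => i; rewrite fnd_restrict block_creature_of.
    rewrite !code_phiE; case: ifP => // iu.
    by rewrite ux// E//; case: letter_at.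
Qed.

Lemma letter_act (d : nat -> code) i0 v l i : tight d -> (l < size v)%N ->
  within (d (i0 + l)%N) i ->
  letter_at ((d i0).1, act (words d) i0 v) i =
    overwrite (letter_at (d (i0 + l)%N) i) (nth None v l).
Proof.
move=> dt; elim: v i0 l => //= y v IH i0 [_|l]; rewrite /letter_at /= nth_cat size_subst.
  rewrite addn0 => /andP[di id_].
  have ilt : (i - (d i0).1 < size (d i0).2)%N.
    by rewrite -(ltn_add2l (d i0).1) subnKC.
  by rewrite ilt (nth_map None).
rewrite ltnS => lv iu; have := IH i0.+1 l lv; rewrite addSnnS => /(_ iu).
have di : ((d i0.+1).1 <= i)%N.
  apply: leq_trans (proj1 (andP iu)).
  by rewrite (start_leq_mono dt); lia.
have := tight_stop i0 dt; rewrite /stop => dS.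
rewrite ltnNge leq_subRL ?dS; last by apply: leq_trans di; rewrite -dS leq_addr.
by rewrite di /= -subnDA dS /letter_at /=.
Qed.

Lemma within_block (d : nat -> code) i0 n i : tight d ->
  ((d i0).1 <= i < (d (i0 + n)%N).1)%N ->
  exists2 l, (l < n)%N & within (d (i0 + l)%N) i.
Proof.
move=> dt; elim: n => [|n IH] /andP[i0i].
  by rewrite addn0 ltnNge i0i.
have [iltn|nlei] := ltnP i (d (i0 + n)%N).1.
  have [|l ln il] := IH; first by rewrite i0i.
  by exists l => //; exact: leqW.
by move=> iS; exists n => //; rewrite nlei tight_stop// -addnS.
Qed.

Lemma Sigma_N_nth (t0 t : creature) ts ts' : ts = t0 :: ts' -> Sigma_N R N ts t <->
  [/\ forall l, (l < size ts)%N -> K_N R N (nth t0 ts l),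
      forall l, (l.+1 < size ts)%N ->
        m_up (nth t0 ts l) = m_dn (nth t0 ts l.+1) &
      K_N R N t] /\
  [/\ m_dn t = m_dn t0,
      m_up t = m_up (nth t0 ts (size ts).-1),
      forall l, (l < size ts)%N -> X_of (nth t0 ts l) `<=` X_of t &
      forall l, (l < size ts)%N ->
        (X_of t `&` block (nth t0 ts l) = X_of (nth t0 ts l) /\
         (phi_of t).[& block (nth t0 ts l)] = phi_of (nth t0 ts l)) \/
        (block (nth t0 ts l) `<=` X_of t /\
         (phi_of t).[& block (nth t0 ts l)] \in val_of (nth t0 ts l))].
Proof. by move=> ->; rewrite nth_last. Qed.

(** The coefficients are the [y] that [substitution_spec] gives block by block. The length is a
    successor because [Sigma_N] is empty at the empty list. *)
Lemma Sigma_N_creature_of (d : nat -> code) x i0 n : (0 < N)%N -> tight d -> None \in x.2 ->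
  Sigma_N R N [seq creature_of (d i) | i <- index_iota i0 (i0 + n.+1)]
    (creature_of x) <->
  exists2 v, size v = n.+1 & x = ((d i0).1, act (words d) i0 v).
Proof.
move=> N_gt0 dt xN; rewrite /index_iota addKn.
set ts := [seq _ | i <- _].
have sts : size ts = n.+1 by rewrite size_map size_iota.
have nts l t0 : (l < n.+1)%N -> nth t0 ts l = creature_of (d (i0 + l)%N).
  by move=> ln; rewrite (nth_map 0) ?size_iota// nth_iota.
pose t0 := creature_of (d i0).
have ets : ts = t0 :: behead ts by [].
have stopE : stop (d (i0 + n)%N) = (d (i0 + n.+1)%N).1 by rewrite tight_stop// addnS.
rewrite (Sigma_N_nth _ ets) sts nts//.
have sub : x.1 = (d i0).1 -> stop x = stop (d (i0 + n)%N) -> forall l, (l < n.+1)%N ->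
    forall i, within (d (i0 + l)%N) i -> within x i.
  move=> x1 sx l ln i /andP[li il]; rewrite x1 sx stopE.
  rewrite (leq_trans _ li) ?(start_leq_mono dt) ?leq_addr//=.
  by apply: (leq_trans il); rewrite tight_stop// (start_leq_mono dt) -addnS leq_add2l.
split.
- move=> [_ [x1 sx _ Hsub]]; rewrite /= in x1 sx.
  have /choice[yf yfP] : forall l, exists y : letter, (l < n.+1)%N ->
      forall i, within (d (i0 + l)%N) i ->
        letter_at x i = overwrite (letter_at (d (i0 + l)%N) i) y.
    move=> l; have [ln|] := boolP (l < n.+1)%N; last by exists None.
    have := Hsub l ln; rewrite nts//.
    move=> /(substitution_spec (sub x1 sx l ln))[y yP].
    by exists y.
  exists (mkseq yf n.+1); first by rewrite size_mkseq.
  have sact := stop_act i0 (mkseq yf n.+1) dt.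
  rewrite size_mkseq -stopE -sx in sact.
  case: x xN x1 sx sub yfP sact {Hsub} => p w /= _ p1 sx sub yfP.
  rewrite -p1 /stop /= => /addnI sact; congr (_, _).
  apply: (@eq_from_nth _ None) => // k kw.
  have [|l ln il] := @within_block d i0 n.+1 (p + k) dt.
    by rewrite -stopE -sx -p1 leq_addr /stop /= ltn_add2l.
  have := yfP l ln _ il; rewrite /letter_at /= addKn => ->.
  have := @letter_act d i0 (mkseq yf n.+1) l _ dt _ il.
  by rewrite size_mkseq => /(_ ln); rewrite /letter_at /= -p1 addKn nth_mkseq.
- move=> [v sv xE].
  have x1 : x.1 = (d i0).1 by rewrite xE.
  have sx : stop x = stop (d (i0 + n)%N).
    by rewrite stopE xE /stop /= stop_act// sv.
  have Hsub l : (l < n.+1)%N -> exists y : letter,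
      forall i, within (d (i0 + l)%N) i ->
        letter_at x i = overwrite (letter_at (d (i0 + l)%N) i) y.
    move=> ln; exists (nth None v l) => i il.
    by rewrite xE; apply: letter_act => //; rewrite sv.
  split; split=> //.
  + move=> l ln; rewrite nts//.
    by apply: K_N_creature_of => //; exact: tight_None.
  + move=> l ln; rewrite !nts//; last exact: ltnW.
    by rewrite /= tight_stop// addnS.
  + exact: K_N_creature_of.
  + move=> l ln; rewrite nts//.
    have [y yP] := Hsub l ln.
    apply/fsubsetP => i; rewrite !X_of_creature_of !code_phiE.
    case: ifP => // il; rewrite (sub x1 sx l ln i il) yP//.
    by case: letter_at.
  + move=> l ln; rewrite nts//.
    by apply/(substitution_spec (sub x1 sx l ln)); exact: Hsub.
Qed.

End Creatures.

(** * Transport of fusion and pigeonhole along an injective recoding of entries *)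

Section Transport.
Context (T1 T2 : Type) (f : T1 -> T2) (R1 : set (nat -> T1)) (R2 : set (nat -> T2)).
Context (le1 : (nat -> T1) -> (nat -> T1) -> Prop).
Context (le2 : (nat -> T2) -> (nat -> T2) -> Prop).
Hypothesis f_inj : injective f.
Hypothesis R2E : forall t, R2 t <-> exists2 c, R1 c & t = f \o c.
Hypothesis le2E : forall c d, R1 c -> R1 d -> le2 (f \o c) (f \o d) <-> le1 c d.

Lemma restr_comp k (c : nat -> T1) : restr k (f \o c) = map f (restr k c).
Proof. exact: map_comp. Qed.

Lemma R2_comp c : R1 c -> R2 (f \o c).
Proof. by move=> Rc; apply/R2E; exists c. Qed.

Lemma nbd_comp a c s : R1 c -> R1 s ->
  nbd R2 le2 (map f a) (f \o c) (f \o s) <-> nbd R1 le1 a c s.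
Proof.
move=> Rc Rs; split=> -[_ sc Ea]; split=> //.
- exact/le2E.
- by move: Ea; rewrite size_map restr_comp; exact: inj_map.
- exact: R2_comp.
- exact/le2E.
- by rewrite size_map restr_comp Ea.
Qed.

Lemma nbd_compP a c t : R1 c -> nbd R2 le2 a (f \o c) t ->
  exists b s, [/\ R1 s, a = map f b, t = f \o s & nbd R1 le1 b c s].
Proof.
move=> Rc at_; have [/R2E[s Rs ts] _ Ea] := at_; subst t.
have aE : a = map f (restr (size a) s) by rewrite -restr_comp.
exists (restr (size a) s), s; split=> //.
by apply/(nbd_comp _ Rc Rs); rewrite -aE.
Qed.

Lemma transport_quasi_order : quasi_order_on R1 le1 -> quasi_order_on R2 le2.
Proof.
move=> [le_refl le_trans]; split.
  by move=> _ /R2E[c Rc ->]; apply/le2E => //; exact: le_refl.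
move=> _ _ _ /R2E[c Rc ->] /R2E[d Rd ->] /R2E[e Re ->].
by rewrite !le2E//; exact: le_trans.
Qed.

Lemma transport_fusion : fusion_property R1 le1 -> fusion_property R2 le2.
Proof.
move=> fusion P Pher Pdense a _ /R2E[c Rc ->] [t0 at0].
have [b [s0 [Rs0 -> _ bs0]]] := nbd_compP Rc at0.
have [|||s bs sP] := @fusion (fun b c => P (map f b) (f \o c)) _ _ b c Rc.
- move=> b' u u' Ru Ru' u'u; apply: Pher; [exact: R2_comp|exact: R2_comp|].
  move=> _ /(nbd_compP Ru')[b1 [v [Rv /(inj_map f_inj) <- -> b1v]]].
  by apply/nbd_comp => //; exact: u'u.
- move=> b' u Ru [w bw]; have Rw : R1 w by case: bw.
  have [|_ /[dup] /(nbd_compP Ru)[b1 [v [Rv Eb -> b1v]]] _ Pv] :=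
      Pdense (map f b') (f \o u) (R2_comp Ru).
    by exists (f \o w); apply/nbd_comp.
  by exists v => //; rewrite (inj_map f_inj Eb).
- by exists s0.
have Rs : R1 s by case: bs.
exists (f \o s); first exact/nbd_comp.
move=> k _ /(nbd_compP Rs)[b1 [v [Rv Eb -> b1v]]].
rewrite size_map restr_comp; apply: sP.
by rewrite (inj_map f_inj Eb).
Qed.

Lemma transport_pigeonhole : pigeonhole_property R1 le1 -> pigeonhole_property R2 le2.
Proof.
move=> pigeonhole Q a _ /R2E[c Rc ->] [t0 at0].
have [b [s0 [Rs0 -> _ bs0]]] := nbd_compP Rc at0.
have [|s bs sQ] := pigeonhole (Q \o f) b c Rc; first by exists s0.
have Rs : R1 s by case: bs.
exists (f \o s); first exact/nbd_comp.
by case: sQ => sQ; [left|right] => _ /(nbd_compP Rs)[b1 [v [Rv Eb -> b1v]]];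
  rewrite size_map; apply: sQ; rewrite (inj_map f_inj Eb).
Qed.

End Transport.

(** * Pure candidates as tight sequences of codes *)

Section PureCandidates.
Context (R : realType) (N : nat) (N_gt0 : (0 < N)%N).
Notation creature_of := (@creature_of R N).
Notation tight := (@tight 'I_N).

Lemma tight_pure_candidatesE t : tight_pure_candidates (K_N R N) t <->
  exists2 c, tight c & t = creature_of \o c.
Proof.
split=> [[Kt adj _]|[c ct ->]].
  have /choice[c cP] : forall n, exists x, None \in x.2 /\ t n = creature_of x.
    by move=> n; have [x] := K_N_surj (Kt n); exists x.
  exists c; last by apply/funext => n; case: (cP n).
  move=> n; split; first by case: (cP n).
  by have := adj n; have [_ ->] := cP n; have [_ ->] := cP n.+1.
split=> [n|n|].
- by apply: K_N_creature_of => //; exact: tight_None.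
- exact: tight_stop.
(* The norm is the end of the block, which is at least [n] since starts increase strictly. *)
- apply: (ger_cvgy _ (@cvgr_idn R)); apply: nearW => n /=.
  rewrite Num.Theory.ler_nat; apply: leq_trans (leq_start n ct) _.
  exact: leq_addr.
Qed.

(** The index [j n] is where the stretch of [d] used by [c n] begins; tightness of [c] makes the
    next stretch begin where this one ends, so the blocks listed by [Sigma_N] are exactly those
    used. *)
Lemma pc_leE c d : tight c -> tight d ->
  pc_le (Sigma_N R N) (creature_of \o c) (creature_of \o d) <-> reduct c d.
Proof.
move=> ct dt; split.
- move=> [j jlt jS] n; have jn := jlt _ _ (ltnSn n).
  have := jS n; rewrite -(subnKC jn) addSnnS.
  move=> /(Sigma_N_creature_of R _ _ N_gt0 dt (tight_None n ct))[v _ cE].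
  exists (j n), v; split=> //; have := tight_None n ct; rewrite cE.
  by rewrite None_act// => k; exact: tight_None.
- move=> cd; have /choice[iv ivP] : forall n, exists iv, None \in iv.2 /\
      c n = ((d iv.1).1, act (fun k => (d k).2) iv.1 iv.2).
    by move=> n; have [i [v]] := cd n; exists (i, v).
  pose j n := (iv n).1.
  have jS n : j n.+1 = (j n + size (iv n).2)%N.
    apply: (start_inj dt); have [_ cE] := ivP n; have [_ cE'] := ivP n.+1.
    have := tight_stop n ct; rewrite cE cE' /stop /= => <-.
    by rewrite stop_act.
  have iv0 n : (0 < size (iv n).2)%N by have [] := ivP n; case: (iv n).2.
  exists j => [|n].
    by apply: (homo_ltn ltn_trans) => n; rewrite jS -[ltnLHS]addn0 ltn_add2l.
  have [_ cE] := ivP n; rewrite jS -(prednK (iv0 n)).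
  apply/(Sigma_N_creature_of R _ _ N_gt0 dt (tight_None n ct)).
  by exists (iv n).2 => //; rewrite prednK.
Qed.

End PureCandidates.

Theorem theorem21 (R : realType) (N : nat) (hN : (0 < N)%N) :
  topological_Ramsey_space (tight_pure_candidates (K_N R N)) (pc_le (Sigma_N R N)).
Proof.
have candE := @tight_pure_candidatesE R N hN; have leE := @pc_leE R N hN.
have inj : injective (@creature_of R N) by exact: creature_of_inj.
apply: ellentuck_theorem.
- apply: (transport_quasi_order candE leE); split=> [c _|c d e ct dt et].
    exact: reduct_refl.
  exact: reduct_trans.
- exact: (transport_fusion inj candE leE (@code_fusion _)).
- exact: (transport_pigeonhole inj candE leE (@code_pigeonhole _)).
Qed.
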